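(* Let $k,l$ be positive integers with $k$ odd. Let $\sigma,\tau$ be nonzero complex numbers such that the numbers $\tau_1=(2\pi i)^{l-k}\tau$ and $\sigma_1=(-1)^{l-k}(2\pi i)^{l-k}\overline{\sigma}$ are different and have nonzero imaginary parts of the same sign. Suppose that $f,g,f_1,g_1\in\mathcal{D}(\mathbb{R}^2)$ satisfy $$(\partial_1^k-\tau\partial_2^l)f_1=f,\qquad(\partial_1^k-\sigma\partial_2^l)g_1=g.$$ Then $$\left|\langle f_1,g_1\rangle_{W_2^{\frac{k-1}{2},\frac{l-1}{2}}(\mathbb{R}^2)}\right|\leqslant C_{\tau,\sigma}\|f\|_{L^1(\mathbb{R}^2)}\|g\|_{L^1(\mathbb{R}^2)},$$ where $C_{\tau,\sigma}$ depends only on $\tau,\sigma$ (and $k,l$).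
   Context: $\mathcal{D}(\mathbb{R}^2)$ is the space of infinitely differentiable compactly supported functions on the plane. The Fourier transform is $\hat f(\xi,\eta)=\int_{\mathbb{R}^2}f(x,y)e^{-2\pi i(x\xi+y\eta)}\,dx\,dy$. The scalar product is $\langle f_1,g_1\rangle_{W_2^{\frac{k-1}{2},\frac{l-1}{2}}(\mathbb{R}^2)}=\int_{\mathbb{R}^2}\hat f_1(\xi,\eta)\overline{\hat g_1(\xi,\eta)}\,|\xi|^{k-1}|\eta|^{l-1}\,d\xi\,d\eta$. *)

(* Defs.v *)
From HB Require Import structures.
From mathcomp Require Import all_boot all_order all_algebra.
From mathcomp Require Import all_classical all_reals all_analysis.
From mathcomp Require Import complex.
Set Implicit Arguments. Unset Strict Implicit. Unset Printing Implicit Defensive.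
Import Order.TTheory GRing.Theory Num.Theory.
Import numFieldNormedType.Exports.
Local Open Scope ring_scope.
Local Open Scope complex_scope.

Section Defs.
Variable R : realType.

Definition leb2 := ((@lebesgue_measure R) \x (@lebesgue_measure R))%E.

Definition cre (z : R[i]) : R := complex.Re z.
Definition cim (z : R[i]) : R := complex.Im z.
Definition cabs (z : R[i]) : R := Num.sqrt (cre z ^+ 2 + cim z ^+ 2).

Definition expi (t : R) : R[i] := (cos t) +i* (sin t).

Definition cint (F : R * R -> R[i]) : R[i] :=
  (Rintegral leb2 setT (fun p => cre (F p))) +i*
  (Rintegral leb2 setT (fun p => cim (F p))).

Definition pd1 (f : R * R -> R[i]) : R * R -> R[i] := fun p =>
  (derive1 (fun t => cre (f (t, p.2))) p.1) +i*
  (derive1 (fun t => cim (f (t, p.2))) p.1).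
Definition pd2 (f : R * R -> R[i]) : R * R -> R[i] := fun p =>
  (derive1 (fun t => cre (f (p.1, t))) p.2) +i*
  (derive1 (fun t => cim (f (p.1, t))) p.2).

Definition pdw (w : seq bool) (f : R * R -> R[i]) : R * R -> R[i] :=
  foldr (fun b h => if b then pd1 h else pd2 h) f w.

Definition smooth2 (f : R * R -> R[i]) : Prop :=
  forall w : seq bool,
    let g := pdw w f in
    continuous (fun p : R * R => cre (g p)) /\ continuous (fun p : R * R => cim (g p)) /\
    (forall p : R * R,
      derivable (fun t => cre (g (t, p.2))) p.1 1 /\
      derivable (fun t => cim (g (t, p.2))) p.1 1 /\
      derivable (fun t => cre (g (p.1, t))) p.2 1 /\
      derivable (fun t => cim (g (p.1, t))) p.2 1).

Definition compact_support2 (f : R * R -> R[i]) : Prop :=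
  exists M : R, forall p : R * R, (M < `|p.1| \/ M < `|p.2|) -> f p = 0.

Definition test_fun (f : R * R -> R[i]) : Prop := smooth2 f /\ compact_support2 f.

Definition fourier2 (f : R * R -> R[i]) : R * R -> R[i] := fun q =>
  cint (fun p => f p * expi (- (2 * pi) * (p.1 * q.1 + p.2 * q.2))).

Definition Wdot (k l : nat) (f1 g1 : R * R -> R[i]) : R[i] :=
  cint (fun q => fourier2 f1 q * conjc (fourier2 g1 q) *
                 ((`|q.1| ^+ (k - 1) * `|q.2| ^+ (l - 1))%:C)).

Definition L1norm (f : R * R -> R[i]) : R := Rintegral leb2 setT (fun p => cabs (f p)).

End Defs.

(* Main.v *)
Require Import Defs.
From HB Require Import structures.
From mathcomp Require Import all_boot all_order all_algebra.
From mathcomp Require Import all_classical all_reals all_analysis.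
From mathcomp Require Import complex.
From mathcomp Require Import measurable_realfun.
From mathcomp Require Import ring lra zify.
Set Implicit Arguments. Unset Strict Implicit. Unset Printing Implicit Defensive.
Import Order.TTheory GRing.Theory Num.Theory.
Import numFieldNormedType.Exports.
Local Open Scope classical_set_scope.
Local Open Scope ring_scope.
Local Open Scope complex_scope.

(** On the Fourier side, [fourier2 f] and the conjugate of [fourier2 g] are, up
    to constants of modulus at least 1, [fourier2 f1] and the conjugate of
    [fourier2 g1] multiplied by [xi ^ k - tau1 * eta ^ l] and
    [xi ^ k - sigma1 * eta ^ l].  The scalar product is therefore the integral
    of their product against the kernel
      [xi ^ (k-1) * |eta| ^ (l-1) / ((xi ^ k - tau1 eta ^ l) (xi ^ k - sigma1 eta ^ l))],
    the parity of [k] making [|xi| ^ (k-1) = xi ^ (k-1)].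
    For fixed [eta != 0] the kernel is integrable in [xi], and it suffices to
    bound its Fourier transform in [xi] at frequency [c] by a function whose
    integral over [eta] is bounded independently of [c].
    For small [|c| |eta| ^ (l/k)] the bound uses the cancellation that the
    integral of the kernel in [xi] is zero: as [k] is odd, the kernel is, up to
    a factor, the derivative of a difference of logarithms, and the logarithms
    cancel at both infinities because [tau1] and [sigma1] lie in the same half
    plane.  For large [|c| |eta| ^ (l/k)] one integrates by parts once.
    Below, [k = j.+1] and [l = i.+1]. *)

(** The obstacle is a logarithmic divergence. The substitution t = xi^k shows that the modulus of
    the kernel has an integral in xi of order 1 / |eta|, so the kernel is not absolutely integrable
    on the plane, neither near eta = 0 nor for large eta. Moduli may be taken only after the
    transform in xi, at the frequency c = - 2 pi (p.1 - p'.1) produced by two points p, p' where f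
    and g are evaluated. This c sets the scale at which both divergences stop: cancellation handles
    small eta and integration by parts handles large eta. For fixed eta the phases in the second
    variables have modulus one and are discarded, so only first coordinates enter c. No closed form
    is sought for the bound on the transform: it stays an integral over xi of a positive majorant
    [wker]. Tonelli then lets eta be integrated first, where the weight has an elementary primitive.
    What remains is a multiple of |c| / (1 + (c xi)^2), whose integral is at most pi by scaling;
    this is where uniformity in c comes from. *)

Section ComplexAbs.
Context {R : realType}.
Implicit Types z w : R[i].

Lemma cabsE z : cabs z = Normc.normc z.
Proof. by case: z. Qed.

Lemma cabs_ge0 z : 0 <= cabs z.
Proof. exact: sqrtr_ge0. Qed.

Lemma cabsM z w : cabs (z * w) = cabs z * cabs w.
Proof. by rewrite !cabsE Normc.normcM. Qed.

Lemma cabsV z : cabs z^-1 = (cabs z)^-1.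
Proof. by rewrite !cabsE Normc.normcV. Qed.

Lemma cabsN z : cabs (- z) = cabs z.
Proof. by rewrite !cabsE normcN. Qed.

Lemma cabsD z w : cabs (z + w) <= cabs z + cabs w.
Proof. by rewrite !cabsE le_normcD. Qed.

Lemma cabsB z w : cabs (z - w) <= cabs z + cabs w.
Proof. by rewrite -(cabsN w) cabsD. Qed.

Lemma cabsX z n : cabs (z ^+ n) = cabs z ^+ n.
Proof.
elim: n => [|n ih]; last by rewrite !exprS cabsM ih.
by rewrite !expr0 cabsE Normc.normc1.
Qed.

Lemma cabsR (x : R) : cabs x%:C = `|x|.
Proof. by rewrite /cabs /cre /cim /= expr0n /= addr0 sqrtr_sqr. Qed.

Lemma cabs0 : cabs (0 : R[i]) = 0.
Proof. by rewrite cabsR normr0. Qed.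

Lemma cabs_eq0 z : (cabs z == 0) = (z == 0).
Proof.
apply/eqP/eqP => [|->]; last exact: cabs0.
by rewrite cabsE; exact: Normc.eq0_normc.
Qed.

Lemma cabs_gt0 z : (0 < cabs z) = (z != 0).
Proof. by rewrite lt_neqAle cabs_ge0 andbT eq_sym cabs_eq0. Qed.

Lemma cabs_conj z : cabs (conjc z) = cabs z.
Proof. by case: z => a b; rewrite /cabs /cre /cim /= sqrrN. Qed.

Lemma cabs_expi (t : R) : cabs (expi t) = 1.
Proof. by rewrite /cabs /cre /cim /expi /= cos2Dsin2 sqrtr1. Qed.

Lemma cabs_ge_re z : `|cre z| <= cabs z.
Proof. by rewrite -sqrtr_sqr ler_wsqrtr// lerDl sqr_ge0. Qed.

Lemma cabs_ge_im z : `|cim z| <= cabs z.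
Proof. by rewrite -sqrtr_sqr ler_wsqrtr// lerDr sqr_ge0. Qed.

Lemma cabs_le_reim z : cabs z <= `|cre z| + `|cim z|.
Proof.
case: z => a b; rewrite /cre /cim /=.
have -> : a +i* b = a%:C + 0 +i* 1 * b%:C by simpc.
apply: le_trans (cabsD _ _) _; rewrite cabsM !cabsR.
by rewrite /cabs /cre /cim /= expr0n expr1n add0r sqrtr1 mul1r.
Qed.

Lemma conjcM z w : conjc (z * w) = conjc z * conjc w.
Proof. by case: z => a b; case: w => c d; simpc; congr (_ +i* _); ring. Qed.

Lemma mulc_conj z : z * conjc z = (cabs z ^+ 2)%:C.
Proof.
case: z => a b; rewrite /cabs sqr_sqrtr ?addr_ge0 ?sqr_ge0//= /cre /cim /=.
by simpc; congr (_ +i* _); ring.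
Qed.

Lemma expiD (s t : R) : expi (s + t) = expi s * expi t.
Proof. by rewrite /expi cosD sinD; simpc; congr (_ +i* _); ring. Qed.

Lemma conj_expi (t : R) : conjc (expi t) = expi (- t).
Proof. by rewrite /expi cosN sinN. Qed.

Lemma creM z w : cre (z * w) = cre z * cre w - cim z * cim w.
Proof. by case: z => a b; case: w => c d. Qed.

Lemma cimM z w : cim (z * w) = cre z * cim w + cim z * cre w.
Proof. by case: z => a b; case: w => c d; rewrite /cim/cre/= [a * d + _]addrC addrC. Qed.

Lemma creD z w : cre (z + w) = cre z + cre w.
Proof. by case: z => a b; case: w => c d. Qed.

Lemma cimD z w : cim (z + w) = cim z + cim w.
Proof. by case: z => a b; case: w => c d. Qed.

Lemma creN z : cre (- z) = - cre z. Proof. by case: z. Qed.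
Lemma cimN z : cim (- z) = - cim z. Proof. by case: z. Qed.

Lemma creV z : cre z^-1 = cre z / cabs z ^+ 2.
Proof.
by case: z => a b; rewrite /cabs sqr_sqrtr ?addr_ge0 ?sqr_ge0.
Qed.

Lemma cimV z : cim z^-1 = - cim z / cabs z ^+ 2.
Proof.
by case: z => a b; rewrite /cabs sqr_sqrtr ?addr_ge0 ?sqr_ge0//= /cim/= mulNr.
Qed.

Lemma cplx_eqP z w : cre z = cre w -> cim z = cim w -> z = w.
Proof. by case: z => a b; case: w => c d; rewrite /cre/cim/= => -> ->. Qed.

Lemma creCM (x : R) z : cre (x%:C * z) = x * cre z.
Proof. by rewrite creM /cre/cim/= mul0r subr0. Qed.

Lemma cimCM (x : R) z : cim (x%:C * z) = x * cim z.
Proof. by rewrite cimM /cre/cim/= mul0r addr0. Qed.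

End ComplexAbs.

(** * Measurability of the real inverse and of complex-valued functions *)

Lemma measurable_invr {R : realType} : measurable_fun setT (fun x : R => x^-1).
Proof.
(* Inversion is discontinuous at 0, but [powR] is measurable. The outer factor x restores the sign
   and gives the value 0 at 0 required by the convention 0^-1 = 0. *)
have -> : (fun x : R => x^-1) = (fun x => x * (`|x| `^ (-1)) ^+ 2).
  apply/funext => x; rewrite powR_inv1//.
  have [->|x0] := eqVneq x 0; first by rewrite invr0 mul0r.
  rewrite exprVn -normrX ger0_norm ?sqr_ge0// expr2 invfM mulrA mulfV// mul1r.
  by [].
apply: measurable_funM => //; apply: measurable_funX.
apply: (@measurableT_comp _ _ _ _ _ _ (fun x : R => x `^ (-1)) _ (fun x : R => `|x|)).
  exact: measurable_powR.
exact: normr_measurable.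
Qed.

Section ComplexMeasurable.
Context {R : realType} {d : measure_display} {T : measurableType d}.
Implicit Types (F G : T -> R[i]).

Definition cmeasurable F :=
  measurable_fun setT (fun x => cre (F x)) /\
  measurable_fun setT (fun x => cim (F x)).

Lemma cmeasurable_cst (c : R[i]) : cmeasurable (fun=> c).
Proof. by split; exact: measurable_cst. Qed.

Lemma cmeasurable_real (u : T -> R) :
  measurable_fun setT u -> cmeasurable (fun x => (u x)%:C).
Proof. by move=> mu; split => //=; exact: measurable_cst. Qed.

Lemma cmeasurableM F G :
  cmeasurable F -> cmeasurable G -> cmeasurable (fun x => F x * G x).
Proof.
move=> [F1 F2] [G1 G2]; split.
  by under eq_fun do rewrite creM; apply: measurable_funB; exact: measurable_funM.
by under eq_fun do rewrite cimM; apply: measurable_funD; exact: measurable_funM.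
Qed.

Lemma cmeasurable_conj F : cmeasurable F -> cmeasurable (fun x => conjc (F x)).
Proof.
move=> [F1 F2]; split.
  by rewrite (_ : (fun x => _) = (fun x => cre (F x)))//; apply/funext => x; case: (F x).
rewrite (_ : (fun x => _) = (fun x => - cim (F x))); first exact: measurable_funN.
by apply/funext => x; case: (F x).
Qed.

Lemma measurable_cabs F : cmeasurable F -> measurable_fun setT (fun x => cabs (F x)).
Proof.
move=> [F1 F2]; rewrite /cabs.
apply: (measurableT_comp (f := @Num.sqrt R)).
  by apply: continuous_measurable_fun => x; exact: sqrt_continuous.
by apply: measurable_funD; exact: measurable_funX.
Qed.

Lemma cmeasurable_expi (u : T -> R) :
  measurable_fun setT u -> cmeasurable (fun x => expi (u x)).
Proof.
move=> mu; split; rewrite /cre /cim/=.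
  apply: (measurableT_comp (f := @cos R)) => //.
  by apply: continuous_measurable_fun; exact: continuous_cos.
apply: (measurableT_comp (f := @sin R)) => //.
by apply: continuous_measurable_fun; exact: continuous_sin.
Qed.

End ComplexMeasurable.

Lemma cmeasurable_comp {R : realType} {d d'} {T : measurableType d}
    {T' : measurableType d'} (F : T' -> R[i]) (h : T -> T') :
  measurable_fun setT h -> cmeasurable F -> cmeasurable (fun x => F (h x)).
Proof. by move=> mh [F1 F2]; split; [exact: (measurableT_comp F1 mh)|exact: (measurableT_comp F2 mh)]. Qed.

(** * Complex-valued integrals for an arbitrary measure *)

Section ComplexIntegral.
Context {R : realType} {d : measure_display} {T : measurableType d}.
Variable mu : {measure set T -> \bar R}.
Implicit Types (F G : T -> R[i]).

(** For the product Lebesgue measure this is convertible to [cint], so that Fourier transforms and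
    the scalar product are instances of it by computation. *)
Definition cintegral F : R[i] :=
  (Rintegral mu setT (fun x => cre (F x))) +i*
  (Rintegral mu setT (fun x => cim (F x))).

Definition cintegrable F :=
  mu.-integrable setT (fun x => (cre (F x))%:E) /\
  mu.-integrable setT (fun x => (cim (F x))%:E).

Lemma cintegrable_measurable F : cintegrable F -> cmeasurable F.
Proof.
by move=> [/integrableP[/measurable_EFinP ? _] /integrableP[/measurable_EFinP ? _]].
Qed.

Lemma le_cintegrable F (g : T -> R) : cmeasurable F ->
  (forall x, cabs (F x) <= g x) -> mu.-integrable setT (EFin \o g) ->
  cintegrable F.
Proof.
move=> [F1 F2] Fg ig; split; apply: le_integrable ig => //;
  try exact/measurable_EFinP;
  move=> x _ /=; rewrite lee_fin; apply: le_trans (ler_norm _);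
  apply: le_trans (Fg x); [exact: cabs_ge_re|exact: cabs_ge_im].
Qed.

Lemma cintegrable_cabs F : cintegrable F -> mu.-integrable setT (fun x => (cabs (F x))%:E).
Proof.
move=> iF; have mF := cintegrable_measurable iF; case: iF => F1 F2.
apply: (@le_integrable _ _ _ _ _ _ _ (fun x => (`|cre (F x)| + `|cim (F x)|)%:E)) => //.
- by apply/measurable_EFinP; exact: measurable_cabs.
- move=> x _ /=; rewrite lee_fin ger0_norm ?cabs_ge0//.
  by rewrite ger0_norm ?addr_ge0//; exact: cabs_le_reim.
- under eq_fun do rewrite EFinD.
  by apply: integrableD => //; exact: integrable_norm.
Qed.

Lemma cintegrableP F : cmeasurable F ->
  (\int[mu]_x (cabs (F x))%:E < +oo)%E -> cintegrable F.
Proof.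
move=> mF oo; apply: (le_cintegrable (g := fun x => cabs (F x))) => //.
apply/integrableP; split; first by apply/measurable_EFinP; exact: measurable_cabs.
by under eq_integral => x _ do rewrite /= ger0_norm ?cabs_ge0//.
Qed.

Lemma cintegrableM F (c : R[i]) : cintegrable F -> cintegrable (fun x => c * F x).
Proof.
move=> iF; have mF := cintegrable_measurable iF.
apply: (le_cintegrable (g := fun x => cabs c * cabs (F x))).
- by apply: cmeasurableM => //; exact: cmeasurable_cst.
- by move=> x; rewrite cabsM.
- rewrite /comp; under eq_fun do rewrite EFinM.
  by apply: integrableZl => //; exact: cintegrable_cabs.
Qed.

Lemma cintegrableD F G : cintegrable F -> cintegrable G ->
  cintegrable (fun x => F x + G x).
Proof.
move=> [F1 F2] [G1 G2]; split.
  by under eq_fun do rewrite creD EFinD; exact: integrableD.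
by under eq_fun do rewrite cimD EFinD; exact: integrableD.
Qed.

Lemma eq_cintegral F G : F =1 G -> cintegral F = cintegral G.
Proof. by move=> /funext ->. Qed.

Lemma cintegralD F G : cintegrable F -> cintegrable G ->
  cintegral (fun x => F x + G x) = cintegral F + cintegral G.
Proof.
move=> [F1 F2] [G1 G2]; rewrite /cintegral.
under eq_Rintegral do rewrite creD.
under [X in _ +i* X]eq_Rintegral do rewrite cimD.
by rewrite !RintegralD.
Qed.

Lemma cintegralM F (c : R[i]) : cintegrable F ->
  cintegral (fun x => c * F x) = c * cintegral F.
Proof.
move=> [F1 F2]; rewrite /cintegral.
under eq_Rintegral do rewrite creM.
under [X in _ +i* X]eq_Rintegral do rewrite cimM.
have Z (r : R) (h : T -> R) : mu.-integrable setT (fun x => (h x)%:E) ->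
    mu.-integrable setT (fun x => (r * h x)%:E).
  by move=> ih; under eq_fun do rewrite EFinM; exact: integrableZl.
rewrite RintegralB//; [|exact: Z|exact: Z].
rewrite RintegralD//; [|exact: Z|exact: Z].
by rewrite !RintegralZl//; case: c => a b; simpc; rewrite /cre/cim/=; congr (_ +i* _); ring.
Qed.

Lemma cintegralMr F (c : R[i]) : cintegrable F ->
  cintegral (fun x => F x * c) = cintegral F * c.
Proof.
by move=> iF; under eq_cintegral do rewrite mulrC; rewrite cintegralM// mulrC.
Qed.

Lemma cintegral_conj F : cintegrable F ->
  cintegral (fun x => conjc (F x)) = conjc (cintegral F).
Proof.
move=> [F1 F2]; rewrite /cintegral /=; congr (_ +i* _).
  by apply: eq_Rintegral => x _; case: (F x).
rewrite -mulN1r -RintegralZl//.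
by apply: eq_Rintegral => x _; case: (F x) => a b; rewrite mulN1r.
Qed.

(** Rotating the integral z onto the real axis reduces this to the real case: |z|^2 is the integral
    of Re (conj z * F), which is at most |z| times the integral of |F|. *)
Lemma cabs_cintegral F : cintegrable F ->
  cabs (cintegral F) <= Rintegral mu setT (fun x => cabs (F x)).
Proof.
move=> iF; set z := cintegral F.
have iA := cintegrable_cabs iF.
have [->|z0] := eqVneq z 0; first by rewrite cabs0 Rintegral_ge0// => x _; exact: cabs_ge0.
have zp : 0 < cabs z by rewrite cabs_gt0.
rewrite -(ler_pM2l zp) -expr2.
have -> : cabs z ^+ 2 = cre (conjc z * z) by rewrite mulrC mulc_conj.
rewrite -cintegralM// /cintegral {1}/cre/= -RintegralZl//.
apply: le_Rintegral => //; first by case: (cintegrableM (conjc z) iF).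
  by rewrite /comp; under eq_fun do rewrite EFinM; exact: integrableZl.
move=> x _; apply: le_trans (ler_norm _) _; apply: le_trans (cabs_ge_re _) _.
by rewrite -[X in cabs (X * _)]/(conjc z) cabsM cabs_conj.
Qed.

(** With an extended-real right-hand side measurability is enough, since an infinite bound is
    trivially true. This is the form that combines with Tonelli. *)
Lemma cabs_cintegral_le F : cmeasurable F ->
  ((cabs (cintegral F))%:E <= \int[mu]_x (cabs (F x))%:E)%E.
Proof.
move=> mF; have [->|oo] := eqVneq (\int[mu]_x (cabs (F x))%:E)%E +oo%E.
  by rewrite leey.
have iF : cintegrable F by apply: cintegrableP => //; rewrite ltey.
rewrite -[leRHS]fineK; last first.
  by apply: integrable_fin_num => //; exact: cintegrable_cabs.
by rewrite lee_fin; exact: cabs_cintegral.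
Qed.

End ComplexIntegral.

(** * Fubini for real and complex integrals *)

Section ComplexFubini.
Context {R : realType} {d1 d2 : measure_display}.
Context {T1 : measurableType d1} {T2 : measurableType d2}.
Variable m1 : {sigma_finite_measure set T1 -> \bar R}.
Variable m2 : {sigma_finite_measure set T2 -> \bar R}.
Implicit Types (f : T1 * T2 -> R) (F : T1 * T2 -> R[i]).

(** Integrability of the sections is avoided: the integrals of the positive and negative parts are
    measurable by Tonelli, and [fine] and subtraction preserve measurability. *)
Lemma measurable_Rintegral_snd f : measurable_fun setT f ->
  measurable_fun setT (fun x => Rintegral m2 setT (fun y => f (x, y))).
Proof.
move=> mf; rewrite /Rintegral.
apply: (@measurableT_comp _ _ _ _ _ _ (@fine R)); first exact: fine_measurable.
under eq_fun do rewrite integralE.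
have mp : measurable_fun setT (fubini_F m2 (EFin \o f)^\+%E).
  apply: measurable_fun_fubini_tonelli_F => //.
  by apply: measurable_funepos; exact/measurable_EFinP.
have mn : measurable_fun setT (fubini_F m2 (EFin \o f)^\-%E).
  apply: measurable_fun_fubini_tonelli_F => //.
  by apply: measurable_funeneg; exact/measurable_EFinP.
rewrite (_ : (fun x => _) = (fun x => fubini_F m2 (EFin \o f)^\+ x
    - fubini_F m2 (EFin \o f)^\- x)%E); first exact: emeasurable_funB.
apply/funext => x; congr (_ - _)%E; apply: eq_integral => y _.
  by rewrite !funeposE.
by rewrite !funenegE.
Qed.

(** The inner [Rintegral] replaces infinite values through [fine], so it agrees with the extended
    inner integral only where the section is integrable, that is, almost everywhere. *)
Lemma Rintegral12_prod f : (m1 \x m2)%E.-integrable setT (EFin \o f) ->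
  Rintegral m1 setT (fun x => Rintegral m2 setT (fun y => f (x, y))) =
  Rintegral (m1 \x m2)%E setT f.
Proof.
move=> intf; rewrite {1 3}/Rintegral -integral12_prod_meas1//.
congr fine; apply: ae_eq_integral => //.
- apply/measurable_EFinP; apply: measurable_Rintegral_snd.
  by have /integrableP[/measurable_EFinP] := intf.
- exact: (measurable_fubini_F intf).
- have := ae_integrable1 intf; apply: filterS => x ix _ /=.
  by rewrite /Rintegral fineK//; exact: integrable_fin_num.
Qed.

Lemma cmeasurable_cintegral_snd F : cmeasurable F ->
  cmeasurable (fun x => cintegral m2 (fun y => F (x, y))).
Proof.
move=> [F1 F2]; split; rewrite /cintegral{1}/cre{1}/cim/=.
  exact: (measurable_Rintegral_snd F1).
exact: (measurable_Rintegral_snd F2).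
Qed.

End ComplexFubini.

Section ComplexFubini2.
Context {R : realType} {d1 d2 : measure_display}.
Context {T1 : measurableType d1} {T2 : measurableType d2}.
Variable m1 : {sigma_finite_measure set T1 -> \bar R}.
Variable m2 : {sigma_finite_measure set T2 -> \bar R}.
Implicit Types (f : T1 * T2 -> R) (F : T1 * T2 -> R[i]).

Lemma Rintegral21_prod f : (m1 \x m2)%E.-integrable setT (EFin \o f) ->
  Rintegral m2 setT (fun y => Rintegral m1 setT (fun x => f (x, y))) =
  Rintegral (m1 \x m2)%E setT f.
Proof.
move=> intf; rewrite {1 3}/Rintegral -integral21_prod_meas1//.
congr fine; apply: ae_eq_integral => //.
- apply/measurable_EFinP.
  have /integrableP[/measurable_EFinP mf _] := intf.
  have mf' := measurableT_comp mf (@measurable_swap _ _ _ _).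
  exact: (measurable_Rintegral_snd m1 mf').
- exact: (measurable_fubini_G intf).
- have := ae_integrable2 intf; apply: filterS => x ix _ /=.
  by rewrite /Rintegral fineK//; exact: integrable_fin_num.
Qed.

Lemma cintegral12_prod F : cintegrable (m1 \x m2)%E F ->
  cintegral m1 (fun x => cintegral m2 (fun y => F (x, y))) =
  cintegral (m1 \x m2)%E F.
Proof.
move=> [F1 F2]; congr (_ +i* _).
  exact: (Rintegral12_prod F1).
exact: (Rintegral12_prod F2).
Qed.

Lemma cintegral21_prod F : cintegrable (m1 \x m2)%E F ->
  cintegral m2 (fun y => cintegral m1 (fun x => F (x, y))) =
  cintegral (m1 \x m2)%E F.
Proof.
move=> [F1 F2]; congr (_ +i* _).
  exact: (Rintegral21_prod F1).
exact: (Rintegral21_prod F2).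
Qed.

(** Separated majorants of this kind give integrability of test functions, of the integrand of the
    scalar product and of the integrand in [cabs_cintegral_fourier2], which justifies the uses of
    Fubini. *)
Lemma cintegrable_prod F (g : T1 -> R) (h : T2 -> R) : cmeasurable F ->
  m1.-integrable setT (EFin \o g) -> m2.-integrable setT (EFin \o h) ->
  (forall x y, cabs (F (x, y)) <= g x * h y) ->
  cintegrable (m1 \x m2)%E F.
Proof.
move=> mF ig ih Fgh.
have mg : measurable_fun setT g by have /integrableP[/measurable_EFinP] := ig.
have mh : measurable_fun setT h by have /integrableP[/measurable_EFinP] := ih.
apply: (le_cintegrable (g := fun p => g p.1 * h p.2)) => //; first by case.
apply/(integrable12ltyP m1 m2).
  apply/measurable_EFinP; apply: measurable_funM.
    exact: (measurableT_comp mg measurable_fst).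
  exact: (measurableT_comp mh measurable_snd).
have H : (\int[m2]_y `|(h y)%:E| < +oo)%E by have /integrableP[] := ih.
have G : (\int[m1]_y `|(g y)%:E| < +oo)%E by have /integrableP[] := ig.
under eq_integral => x _.
  under eq_integral => y _ do rewrite /= normrM EFinM.
  rewrite ge0_integralZl//; last first.
    by apply/measurable_EFinP; exact: measurableT_comp.
  over.
rewrite ge0_integralZr//; last 2 first.
- by apply/measurable_EFinP; exact: measurableT_comp.
- by apply: integral_ge0 => y _.
by rewrite lte_mul_pinfty// ?integral_ge0// ge0_fin_numE// integral_ge0.
Qed.

End ComplexFubini2.

(** * Derivatives and continuity of complex-valued functions, componentwise *)

Section ComplexDerivative.
Context {R : realType}.
Implicit Types (F G : R -> R[i]).

Definition is_cderive (F : R -> R[i]) (x : R) (F' : R[i]) :=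
  is_derive x 1 (fun t => cre (F t)) (cre F') /\
  is_derive x 1 (fun t => cim (F t)) (cim F').

Definition ccontinuous {T : topologicalType} (F : T -> R[i]) :=
  continuous (fun x => cre (F x)) /\ continuous (fun x => cim (F x)).

(** This and the next rules are phrased with explicit abstractions and real multiplication instead
    of operations in the ring of functions, so that they unify with goals written pointwise. *)
Lemma is_deriveMf (f g : R -> R) (x df dg : R) :
  is_derive x 1 f df -> is_derive x 1 g dg ->
  is_derive x 1 (fun t => f t * g t) (f x * dg + g x * df).
Proof. by move=> hf hg; exact: (is_deriveM hf hg). Qed.

Lemma is_deriveDf (f g : R -> R) (x df dg : R) :
  is_derive x 1 f df -> is_derive x 1 g dg ->
  is_derive x 1 (fun t => f t + g t) (df + dg).
Proof. by move=> hf hg; exact: (is_deriveD hf hg). Qed.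

Lemma is_deriveNf (f : R -> R) (x df : R) :
  is_derive x 1 f df -> is_derive x 1 (fun t => - f t) (- df).
Proof. by move=> hf; exact: (is_deriveN hf). Qed.

Lemma is_derive_val (f : R -> R) (x d d' : R) :
  is_derive x 1 f d -> d = d' -> is_derive x 1 f d'.
Proof. by move=> h <-. Qed.

Lemma is_cderive_eq F x d d' : is_cderive F x d -> d = d' -> is_cderive F x d'.
Proof. by move=> h <-. Qed.

Lemma is_cderive_cst (c : R[i]) x : is_cderive (fun=> c) x 0.
Proof. by split; exact: is_derive_cst. Qed.

Lemma is_cderive_real (u : R -> R) (x du : R) :
  is_derive x 1 u du -> is_cderive (fun t => (u t)%:C) x du%:C.
Proof. by move=> h; split => //=; exact: is_derive_cst. Qed.

Lemma is_cderiveD F G x dF dG : is_cderive F x dF -> is_cderive G x dG ->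
  is_cderive (fun t => F t + G t) x (dF + dG).
Proof.
move=> [F1 F2] [G1 G2]; split.
  by under eq_fun do rewrite creD; rewrite creD; exact: is_deriveDf.
by under eq_fun do rewrite cimD; rewrite cimD; exact: is_deriveDf.
Qed.

Lemma is_cderiveN F x dF : is_cderive F x dF ->
  is_cderive (fun t => - F t) x (- dF).
Proof.
move=> [F1 F2]; split.
  by under eq_fun do rewrite creN; rewrite creN; exact: is_deriveNf.
by under eq_fun do rewrite cimN; rewrite cimN; exact: is_deriveNf.
Qed.

Lemma is_cderiveM F G x dF dG : is_cderive F x dF -> is_cderive G x dG ->
  is_cderive (fun t => F t * G t) x (dF * G x + F x * dG).
Proof.
move=> [F1 F2] [G1 G2]; split.
  under eq_fun do rewrite creM.
  apply: (is_derive_val (is_deriveDf (is_deriveMf F1 G1) (is_deriveNf (is_deriveMf F2 G2)))).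
  by rewrite creD !creM; ring.
under eq_fun do rewrite cimM.
apply: (is_derive_val (is_deriveDf (is_deriveMf F1 G2) (is_deriveMf F2 G1))).
by rewrite cimD !cimM; ring.
Qed.

(** The components of 1 / F are Re F / |F|^2 and - Im F / |F|^2, so the only new derivative is that
    of the real function |F|^-2. *)
Lemma is_cderiveV F x dF : F x != 0 -> is_cderive F x dF ->
  is_cderive (fun t => (F t)^-1) x (- dF / F x ^+ 2).
Proof.
move=> F0 [F1 F2].
have sq z : cabs z ^+ 2 = cre z ^+ 2 + cim z ^+ 2 :> R.
  by rewrite /cabs sqr_sqrtr// addr_ge0// sqr_ge0.
have n0 : cre (F x) ^+ 2 + cim (F x) ^+ 2 != 0.
  by rewrite -sq expf_neq0// cabs_eq0.
have sqd : is_derive x 1 (fun t => (cabs (F t) ^+ 2)^-1)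
   (- (cabs (F x) ^+ 2) ^- 2 * (2 * (cre (F x) * cre dF + cim (F x) * cim dF))).
  apply: is_deriveV; first by rewrite expf_neq0// cabs_eq0.
  under eq_fun do rewrite sq !expr2.
  by apply: (is_derive_val (is_deriveDf (is_deriveMf F1 F1) (is_deriveMf F2 F2))); ring.
have E : - dF / F x ^+ 2 = - dF * (F x)^-1 * (F x)^-1 by rewrite expr2 invfM mulrA.
rewrite E; split.
  under eq_fun do rewrite creV.
  apply: (is_derive_val (is_deriveMf F1 sqd)).
  rewrite !creM !cimM !creN !cimN !creV !cimV !sq.
  by field.
under eq_fun do rewrite cimV.
apply: (is_derive_val (is_deriveMf (is_deriveNf F2) sqd)).
rewrite !cimM !creM !creN !cimN !creV !cimV !sq.
by field.
Qed.

Lemma is_cderive_expi (c x : R) :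
  is_cderive (fun t => expi (c * t)) x ((0 +i* c) * expi (c * x)).
Proof.
have lin : is_derive x 1 (fun t : R => c * t) c.
  apply: (is_derive_val (is_deriveMf (is_derive_cst c x 1) (is_derive_id x 1))).
  by rewrite mulr1 mulr0 addr0.
split; rewrite /cre/cim/=.
  have := is_derive1_comp (is_derive_cos (c * x)) lin.
  by move=> h; apply: (is_derive_val h); ring.
have := is_derive1_comp (is_derive_sin (c * x)) lin.
by move=> h; apply: (is_derive_val h); ring.
Qed.

Lemma is_cderive_continuous F dF : (forall x, is_cderive F x (dF x)) -> ccontinuous F.
Proof.
move=> h; split=> x; apply/differentiable_continuous/derivable1_diffP;
  by have [[? _] [? _]] := h x.
Qed.

End ComplexDerivative.

Section ComplexContinuous.
Context {R : realType} {T : topologicalType}.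
Implicit Types (F G : T -> R[i]).

Lemma ccontinuous_cst (c : R[i]) : ccontinuous (fun _ : T => c).
Proof. by split; exact: cst_continuous. Qed.

Lemma ccontinuous_real (u : T -> R) : continuous u -> ccontinuous (fun x => (u x)%:C).
Proof. by move=> cu; split => //=; exact: cst_continuous. Qed.

Lemma ccontinuousD F G : ccontinuous F -> ccontinuous G -> ccontinuous (fun x => F x + G x).
Proof.
move=> [F1 F2] [G1 G2]; split=> x.
  by under eq_fun do rewrite creD; apply: cvgD; [exact: F1|exact: G1].
by under eq_fun do rewrite cimD; apply: cvgD; [exact: F2|exact: G2].
Qed.

Lemma ccontinuousN F : ccontinuous F -> ccontinuous (fun x => - F x).
Proof.
move=> [F1 F2]; split=> x.
  by under eq_fun do rewrite creN; apply: cvgN; exact: F1.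
by under eq_fun do rewrite cimN; apply: cvgN; exact: F2.
Qed.

Lemma ccontinuousM F G : ccontinuous F -> ccontinuous G -> ccontinuous (fun x => F x * G x).
Proof.
move=> [F1 F2] [G1 G2]; split=> x.
  under eq_fun do rewrite creM.
  by apply: cvgB; apply: cvgM; [exact: F1|exact: G1|exact: F2|exact: G2].
under eq_fun do rewrite cimM.
by apply: cvgD; apply: cvgM; [exact: F1|exact: G2|exact: F2|exact: G1].
Qed.

Lemma ccontinuousX F n : ccontinuous F -> ccontinuous (fun x => F x ^+ n).
Proof.
move=> cF; elim: n => [|n ih]; first exact: ccontinuous_cst.
by under eq_fun do rewrite exprS; exact: ccontinuousM.
Qed.

Lemma ccontinuousV F : (forall x, F x != 0) -> ccontinuous F ->
  ccontinuous (fun x => (F x)^-1).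
Proof.
move=> F0 [F1 F2].
have sq z : cabs z ^+ 2 = cre z ^+ 2 + cim z ^+ 2 :> R.
  by rewrite /cabs sqr_sqrtr// addr_ge0// sqr_ge0.
have cV : continuous (fun x => (cabs (F x) ^+ 2)^-1).
  move=> x; apply: cvgV; first by rewrite expf_neq0// cabs_eq0.
  under eq_fun do rewrite sq !expr2.
  by rewrite sq !expr2; apply: cvgD; apply: cvgM; first [exact: F1|exact: F2].
split=> x.
  by under eq_fun do rewrite creV; apply: cvgM; [exact: F1|exact: cV].
by under eq_fun do rewrite cimV; apply: cvgM; [apply: cvgN; exact: F2|exact: cV].
Qed.

Lemma ccontinuous_expi (u : T -> R) : continuous u -> ccontinuous (fun x => expi (u x)).
Proof.
move=> cu; split=> x; rewrite /cre /cim/=.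
  by apply: (@continuous_comp _ _ _ u cos); [exact: cu|exact: continuous_cos].
by apply: (@continuous_comp _ _ _ u sin); [exact: cu|exact: continuous_sin].
Qed.

End ComplexContinuous.

Lemma ccontinuous_measurable {R : realType} (F : R -> R[i]) :
  ccontinuous F -> cmeasurable F.
Proof. by move=> [? ?]; split; exact: continuous_measurable_fun. Qed.

(** * Integrals of derivatives over the whole line *)

Section IntegralOfDerivative.
Context {R : realType}.
Notation mu := (@lebesgue_measure R).

(** Dominated convergence with majorant |g| makes the integral the limit of the integrals over
    [-n, n], which the fundamental theorem evaluates. Only the difference of the two boundary values
    has to vanish in the limit. *)
Lemma Rintegral_derive_eq0 (G g : R -> R) :
  (forall x : R, is_derive x 1 G (g x)) -> continuous g ->
  mu.-integrable setT (EFin \o g) ->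
  (fun n => G n%:R - G (- n%:R)) @ \oo --> (0 : R) ->
  Rintegral mu setT g = 0.
Proof.
move=> dG cg ig lim0.
pose D n : set R := `[- n%:R, n%:R]%classic.
pose f_ n : R -> \bar R := ((EFin \o g) \_ (D n))%E.
have mg : measurable_fun setT (EFin \o g) by have /integrableP[] := ig.
have [_ _ cvf] : [/\ mu.-integrable setT (EFin \o g),
    [sequence \int[mu]_x `|f_ n x - (g x)%:E|]_n @ \oo --> 0%E &
    [sequence \int[mu]_x f_ n x]_n @ \oo --> \int[mu]_x (g x)%:E]%E.
  apply: (@dominated_convergence _ _ _ mu setT measurableT f_ (EFin \o g)
    (abse \o (EFin \o g))) => //.
  - move=> n; apply/(measurable_restrictT _ (_ : measurable (D n))).
      exact: measurable_itv.
    exact: (measurable_funS measurableT (@subsetT _ _) mg).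
  - apply: aeW => x _; apply: cvg_near_cst.
    near=> n; rewrite /f_ patchE ifT// inE /D/= in_itv/= -ler_norml.
    near: n; exact: nbhs_infty_ger.
  - exact: integrable_abse.
  - apply: aeW => x n _; rewrite /f_ patchE; case: ifPn => //= _.
    by rewrite normr0 lee_fin.
have E : (fun n => \int[mu]_x f_ n x)%E = EFin \o (fun n => G n%:R - G (- n%:R)).
  apply/funext => n; rewrite /f_ -integral_mkcond /D /=.
  (* For n = 0 the interval is a point, while the fundamental theorem needs distinct endpoints. *)
  case: n => [|n].
    by rewrite oppr0 set_itv1 integral_set1 subrr.
  rewrite (@continuous_FTC2 _ g G) ?EFinB//.
  - by rewrite gtrN// ltr0n.
  - exact: continuous_subspaceT.
  - have cG : continuous G.
      move=> x; apply/differentiable_continuous/derivable1_diffP.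
      by have [] := dG x.
    split.
    + by move=> x _; have [] := dG x.
    + exact/cvg_at_right_filter/cG.
    + exact/cvg_at_left_filter/cG.
  - by move=> x _; rewrite derive1E; exact: derive_val.
rewrite E in cvf.
rewrite /Rintegral.
have -> : (\int[mu]_x (g x)%:E)%E = 0%:E :> \bar R; last by [].
apply: cvg_unique cvf _ => //.
by apply/fine_cvgP; split; [exact: nearW|exact: lim0].
Unshelve. all: by end_near. Qed.

(** This function serves as the common integrable majorant on the line, for the kernel, its
    derivative, test functions and decaying Fourier transforms. *)
Lemma integrable_oneDsqrV : mu.-integrable setT (fun x : R => ((1 + x ^+ 2)^-1)%:E).
Proof.
have cV : continuous (fun x : R => (1 + x ^+ 2)^-1) by exact: continuous_oneDsqrV.
apply/integrableP; split.
  by apply/measurable_EFinP; exact: continuous_measurable_fun.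
under eq_integral => x _ do rewrite /= ger0_norm ?invr_ge0 ?addr_ge0 ?sqr_ge0//.
rewrite ge0_symfun_integralT//.
- rewrite -set_itvcy integral0y_oneDsqr.
  by rewrite -EFinM ltry.
- by move=> x; rewrite invr_ge0 addr_ge0// sqr_ge0.
- by move=> x /=; rewrite sqrrN.
Qed.

Lemma cvg_oneDsqrV_nat : (fun n : nat => (1 + n%:R ^+ 2 : R)^-1) @ \oo --> (0 : R).
Proof.
have h : (fun n : nat => (n.+1%:R^-1 : R) * 2) @ \oo --> (0 : R).
  by rewrite -[X in _ --> X](mul0r 2); apply: cvgM; [exact: cvg_harmonic|exact: cvg_cst].
apply: (squeeze_cvgr _ (cvg_cst 0) h).
near=> n; rewrite invr_ge0 addr_ge0 ?sqr_ge0//=.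
rewrite -div1r ler_pdivrMr ?ltr_pwDl ?sqr_ge0//.
rewrite mulrAC -mulrA ler_pdivlMl// mulr1 -natr1.
have := sqr_ge0 (n%:R - 1 : R); rewrite sqrrB1; nra.
Unshelve. all: by end_near. Qed.

Lemma le_cintegrable_oneDsqrV (C : R) (F : R -> R[i]) : cmeasurable F ->
  (forall x, cabs (F x) <= C / (1 + x ^+ 2)) -> cintegrable mu F.
Proof.
move=> mF FC; apply: (@le_cintegrable _ _ _ mu F (fun x => C / (1 + x ^+ 2))) => //.
rewrite /comp; under eq_fun do rewrite EFinM.
by apply: integrableZl => //; exact: integrable_oneDsqrV.
Qed.

Lemma cintegral_cderive_eq0 (C : R) (G g : R -> R[i]) :
  (forall x, is_cderive G x (g x)) -> ccontinuous g ->
  (forall x, cabs (G x) <= C / (1 + x ^+ 2)) ->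
  (forall x, cabs (g x) <= C / (1 + x ^+ 2)) -> cintegral mu g = 0.
Proof.
move=> dG cg GC gC.
have [g1 g2] : cintegrable mu g.
  by apply: le_cintegrable_oneDsqrV gC; exact: ccontinuous_measurable.
have lim0 (u : R -> R) : (forall x, `|u x| <= C / (1 + x ^+ 2)) ->
    (fun n => u n%:R - u (- n%:R)) @ \oo --> (0 : R).
  move=> uC; apply/cvgr0Pnorm_le.
  move=> e e0.
  have : (fun n : nat => C * 2 * (1 + n%:R ^+ 2)^-1) @ \oo --> (0 : R).
    rewrite -[X in _ --> X](mulr0 (C * 2)).
    by apply: cvgM; [exact: cvg_cst|exact: cvg_oneDsqrV_nat].
  move=> /cvgr0Pnorm_le/(_ _ e0); apply: filterS => n; apply: le_trans.
  apply: le_trans (ler_normB _ _) _; apply: le_trans (ler_norm _).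
  have := uC n%:R; have := uC (- n%:R); rewrite sqrrN; lra.
case: cg => c1 c2; congr (_ +i* _); apply: Rintegral_derive_eq0 => //.
- exact: (fun x => proj1 (dG x)).
- by apply: lim0 => x; apply: le_trans (GC x); exact: cabs_ge_re.
- exact: (fun x => proj2 (dG x)).
- by apply: lim0 => x; apply: le_trans (GC x); exact: cabs_ge_im.
Qed.

End IntegralOfDerivative.

(** * Elementary pointwise inequalities *)

Section CabsExpi.
Context {R : realType}.

Lemma is_derive_exprn n (x : R) : is_derive x 1 (fun t : R => t ^+ n) (n%:R * x ^+ n.-1).
Proof.
have := is_deriveX n (is_derive_id x (1 : R)).
rewrite exprfctE => h; apply: (is_derive_val h).
by rewrite /GRing.scale/= mulr1.
Qed.

Lemma is_derive_compf (f g : R -> R) (x a b : R) :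
  is_derive (g x) 1 f a -> is_derive x 1 g b -> is_derive x 1 (fun t => f (g t)) (a * b).
Proof. by move=> hf hg; exact: (is_derive1_comp hf hg). Qed.

Lemma le_abs_derive (f g : R -> R) (t : R) : (forall x : R, is_derive x 1 f (g x)) ->
  (forall x, `|g x| <= 1) -> `|f t - f 0| <= `|t|.
Proof.
move=> df g1.
have cf : continuous f.
  by move=> x; apply/differentiable_continuous/derivable1_diffP; have [] := df x.
have [t0|/ltW t0] := leP 0 t.
  have [c _ ->] := MVT_segment t0 (fun x _ => df x) (continuous_subspaceT cf).
  by rewrite subr0 normrM ler_piMl.
have [c _ E] := MVT_segment t0 (fun x _ => df x) (continuous_subspaceT cf).
by rewrite distrC E sub0r normrM normrN ler_piMl.
Qed.

(** The bound 2 is the triangle inequality; 2 |t| adds the Lipschitz bounds of cosine and sine. Both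
    regimes are kept: |t| gives convergence for small eta, and 1 keeps the decay in xi. *)
Lemma cabs_expi_sub1 (t : R) : cabs (expi t - 1) <= 2 * Num.min 1 `|t|.
Proof.
rewrite minr_pMr// mulr1 le_min; apply/andP; split.
  apply: le_trans (cabsB _ _) _.
  by rewrite cabs_expi cabsE Normc.normc1; lra.
apply: le_trans (cabs_le_reim _) _.
have -> : cre (expi t - 1) = cos t - cos 0 by rewrite creD cos0.
have -> : cim (expi t - 1) = sin t - sin 0 by rewrite cimD cimN sin0.
have h1 : `|cos t - cos 0| <= `|t|.
  apply: (@le_abs_derive cos (fun x => - sin x)) => x.
  by rewrite normrN sin_max.
have h2 : `|sin t - sin 0| <= `|t|.
  by apply: (@le_abs_derive sin cos) => x; exact: cos_max.
lra.
Qed.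

(** The two summands of the constant cover two ranges: for x <= 1 the denominator is at least V^q,
    and for x > 1 it is at least x^(q k), which beats x^(p + 2). *)
Lemma le_pow_oneDsqrV (k p q : nat) (V x : R) : (0 < k)%N -> (p + 2 <= q * k)%N -> 0 < V -> 0 <= x ->
  x ^+ p / (x ^+ k + V) ^+ q <= (2 / V ^+ q + 2) / (1 + x ^+ 2).
Proof.
move=> k0 pq V0 x0.
have D0 : 0 < x ^+ k + V by rewrite ltr_wpDl// exprn_ge0.
have q0 : 0 < 1 + x ^+ 2 by rewrite ltr_pwDl// sqr_ge0.
rewrite ler_pdivrMr ?exprn_gt0// mulrAC ler_pdivlMr//.
have [x1|x1] := leP x 1.
  apply: (@le_trans _ _ 2).
    rewrite -[leRHS]mul1r ler_pM// ?exprn_ge0// ?exprn_ile1//.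
    - exact: ltW.
    - by rewrite -[leRHS]/(1 + 1) lerD2l exprn_ile1.
  apply: (@le_trans _ _ (2 / V ^+ q * (x ^+ k + V) ^+ q)); last first.
    by rewrite ler_wpM2r ?exprn_ge0 ?lerDl// ltW.
  rewrite -mulrA ler_peMr// mulrC ler_pdivlMr ?exprn_gt0// mul1r.
  by rewrite lerXn2r ?nnegrE ?lerDr ?exprn_ge0// ltW.
have x1' := ltW x1.
apply: (@le_trans _ _ (2 * (x ^+ k + V) ^+ q)); last first.
  by rewrite ler_wpM2r ?exprn_ge0 ?lerDr// ?divr_ge0 ?exprn_ge0// ltW.
apply: (@le_trans _ _ (2 * x ^+ (p + 2))).
  rewrite exprD mulrCA ler_wpM2l ?exprn_ge0//.
  by have := exprn_ege1 2 x1'; lra.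
rewrite ler_wpM2l//; apply: (@le_trans _ _ (x ^+ (q * k))).
  by rewrite ler_weXn2l.
rewrite mulnC exprM lerXn2r ?nnegrE ?exprn_ge0//; first exact: ltW.
by rewrite lerDl ltW.
Qed.

End CabsExpi.

(** * The integral of the kernel in [xi] vanishes *)

Section Vanishing.
Context {R : realType}.
Notation mu := (@lebesgue_measure R).

Lemma cvgV_nat_exp (k : nat) : (0 < k)%N -> (fun n : nat => (n%:R ^+ k : R)^-1) @ \oo --> (0 : R).
Proof.
move=> k0; apply/cvgr0Pnorm_le => e e0; near=> n.
have n1 : 1 <= n%:R :> R by near: n; exact: nbhs_infty_ger.
rewrite ger0_norm ?invr_ge0 ?exprn_ge0//.
rewrite invf_ple ?posrE ?exprn_gt0// ?(lt_le_trans ltr01)//.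
apply: (@le_trans _ _ n%:R); first by near: n; exact: nbhs_infty_ger.
by rewrite -[leLHS]expr1 ler_weXn2l.
Unshelve. all: by end_near. Qed.

(** Factoring out s^2, with s = sg n^k, leaves the logarithm of a quantity tending to 1. The
    subtracted term depends on no pole, so it cancels between two poles. *)
Lemma cvg_ln_quadratic (k : nat) (al be sg : R) : (0 < k)%N -> sg != 0 -> be != 0 ->
  (fun n : nat => ln (((sg * n%:R ^+ k) - al) ^+ 2 + be ^+ 2)
     - ln ((sg * n%:R ^+ k) ^+ 2)) @ \oo --> (0 : R).
Proof.
move=> k0 sg0 be0.
pose y (n : nat) : R := sg^-1 * (n%:R ^+ k)^-1.
have y0 : y @ \oo --> (0 : R).
  rewrite -[X in _ --> X](mulr0 sg^-1).
  by apply: cvgM; [exact: cvg_cst|exact: cvgV_nat_exp].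
have h : (fun n => ln ((1 - al * y n) ^+ 2 + (be * y n) ^+ 2)) @ \oo --> (0 : R).
  have q : (fun n => (1 - al * y n) ^+ 2 + (be * y n) ^+ 2) @ \oo --> (1 : R).
    have c1 : (fun n => 1 - al * y n) @ \oo --> (1 - al * 0).
      apply: cvgB; first exact: cvg_cst.
      by apply: cvgM; [exact: cvg_cst|exact: y0].
    have c2 : (fun n => be * y n) @ \oo --> (be * 0).
      by apply: cvgM; [exact: cvg_cst|exact: y0].
    have q : (fun n => (1 - al * y n) * (1 - al * y n) + be * y n * (be * y n)) @ \oo
        --> ((1 - al * 0) * (1 - al * 0) + (be * 0) * (be * 0)).
      by apply: cvgD; apply: cvgM.
    have E1 : (1 - al * 0) * (1 - al * 0) + (be * 0) * (be * 0) = 1 by ring.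
    by rewrite E1 in q; under eq_fun do rewrite !expr2.
  rewrite -[X in _ --> X]ln1.
  by apply: (cvg_comp _ _ q); exact: (continuous_ln ltr01).
apply: cvg_trans h; apply: near_eq_cvg; near=> n.
have n1 : 1 <= n%:R :> R by near: n; exact: nbhs_infty_ger.
have nk : n%:R ^+ k != 0 :> R by rewrite expf_neq0// gt_eqF// (lt_le_trans ltr01).
have s0 : sg * n%:R ^+ k != 0 by rewrite mulf_neq0.
have yE : y n = (sg * n%:R ^+ k)^-1 by rewrite /y invfM.
have s2 : 0 < (sg * n%:R ^+ k) ^+ 2 by rewrite lt_neqAle sqr_ge0 andbT eq_sym expf_neq0.
have E : (sg * n%:R ^+ k - al) ^+ 2 + be ^+ 2 =
   (sg * n%:R ^+ k) ^+ 2 * ((1 - al * y n) ^+ 2 + (be * y n) ^+ 2).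
  by rewrite yE; field; rewrite nk sg0.
have q0 : 0 < (1 - al * y n) ^+ 2 + (be * y n) ^+ 2.
  by rewrite ltr_wpDl ?sqr_ge0// lt_neqAle sqr_ge0 andbT eq_sym expf_neq0// mulf_neq0// yE invr_neq0.
by rewrite E lnM ?posrE// addrAC subrr add0r.
Unshelve. all: by end_near. Qed.

Lemma cvg_atan_affine (k : nat) (c be : R) : (0 < k)%N -> 0 < be ->
  (fun n : nat => atan ((n%:R ^+ k + c) / be)) @ \oo --> (pi / 2 : R).
Proof.
move=> k0 b0; apply: (@cvg_comp _ _ _ (fun n : nat => (n%:R ^+ k + c) / be) atan _ (pinfty_nbhs R)).
  apply/cvgryPge => A; near=> n.
  have n1 : 1 <= n%:R :> R by near: n; exact: nbhs_infty_ger.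
  rewrite ler_pdivlMr// -lerBlDr; apply: (@le_trans _ _ n%:R).
    by near: n; exact: nbhs_infty_ger.
  by rewrite -[leLHS]expr1 ler_weXn2l.
exact: cvgy_atan.
Unshelve. all: by end_near. Qed.

(** A branch of log (s - A) up to an additive constant: ln |s - A| plus i times a determination of
    the argument. Writing the argument as an arctangent makes it smooth on the whole line when Im A
    is nonzero, with no branch cut. *)
Definition clog (A : R[i]) (s : R) : R[i] :=
  (2^-1 * ln ((s - cre A) ^+ 2 + cim A ^+ 2)) +i* atan ((s - cre A) / cim A).

Lemma is_cderive_clog (j : nat) (A : R[i]) (x : R) : cim A != 0 ->
  is_cderive (fun t => clog A (t ^+ j.+1)) x ((j.+1%:R * x ^+ j)%:C * ((x ^+ j.+1)%:C - A)^-1).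
Proof.
move=> A0; set al := cre A; set be := cim A.
have dp : is_derive x 1 (fun t : R => t ^+ j.+1 - al) (j.+1%:R * x ^+ j).
  apply: (is_derive_val (is_deriveDf (is_derive_exprn j.+1 x) (is_derive_cst (- al) x 1))).
  by rewrite addr0.
have q0 : 0 < (x ^+ j.+1 - al) ^+ 2 + be ^+ 2.
  by rewrite ltr_wpDl ?sqr_ge0// lt_neqAle sqr_ge0 andbT eq_sym expf_neq0.
have PA : cabs ((x ^+ j.+1)%:C - A) ^+ 2 = (x ^+ j.+1 - al) ^+ 2 + be ^+ 2.
  rewrite /cabs sqr_sqrtr ?addr_ge0 ?sqr_ge0// creD cimD creN cimN -/al -/be.
  by rewrite /cre/cim/= add0r sqrrN.
have PAr : cre ((x ^+ j.+1)%:C - A) = x ^+ j.+1 - al by rewrite creD creN.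
have PAi : cim ((x ^+ j.+1)%:C - A) = - be by rewrite cimD cimN /cim/= add0r.
split.
  have dq : is_derive x 1 (fun t : R => (t ^+ j.+1 - al) ^+ 2 + be ^+ 2)
      (2 * (x ^+ j.+1 - al) * (j.+1%:R * x ^+ j)).
    under eq_fun do rewrite expr2.
    apply: (is_derive_val (is_deriveDf (is_deriveMf dp dp) (is_derive_cst (be ^+ 2) x 1))).
    by ring.
  have h := @is_derive_compf _ (@ln R) (fun t : R => (t ^+ j.+1 - al) ^+ 2 + be ^+ 2) _ _ _ (is_derive1_ln q0) dq.
  have -> : (fun t => cre (clog A (t ^+ j.+1))) =
      (fun t => 2^-1 * ln ((t ^+ j.+1 - al) ^+ 2 + be ^+ 2)) by [].
  apply: (is_derive_val (is_deriveMf (is_derive_cst (2^-1 : R) x 1) h)).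
  rewrite creCM creV PA PAr /cst; field.
  by rewrite gt_eqF.
have dq : is_derive x 1 (fun t : R => (t ^+ j.+1 - al) / be) (j.+1%:R * x ^+ j / be).
  by apply: (is_derive_val (is_deriveMf dp (is_derive_cst be^-1 x 1))); rewrite /cst; ring.
have h := @is_derive_compf _ (@atan R) (fun t : R => (t ^+ j.+1 - al) / be) _ _ _
  (is_derive1_atan ((x ^+ j.+1 - al) / be)) dq.
 have -> : (fun t => cim (clog A (t ^+ j.+1))) =
    (fun t => atan ((t ^+ j.+1 - al) / be)) by [].
apply: (is_derive_val h).
rewrite cimCM cimV PA PAi.
have q1 : 1 + ((x ^+ j.+1 - al) / be) ^+ 2 != 0 by rewrite gt_eqF// ltr_pwDl// sqr_ge0.
field.
rewrite A0 gt_eqF//=; rewrite addrC; exact: gt_eqF.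
Qed.

(** Each arctangent tends to sg sign(b) pi / 2, so the limits agree exactly because b1 and b2 have
    the same sign; with opposite signs they would differ by pi. The parameter [sg] selects the end
    of the line. *)
Lemma cvg_atan_diff (k : nat) (a1 b1 a2 b2 sg : R) : (0 < k)%N -> 0 < b1 * b2 ->
  sg = 1 \/ sg = -1 ->
  (fun n : nat => atan ((sg * n%:R ^+ k - a1) / b1) - atan ((sg * n%:R ^+ k - a2) / b2))
    @ \oo --> (0 : R).
Proof.
move=> k0 b12 sg1.
have H (a b : R) : b != 0 ->
    (fun n : nat => atan ((sg * n%:R ^+ k - a) / b)) @ \oo --> (sg * Num.sg b * (pi / 2)).
  move=> b0.
  (* Oddness of the arctangent moves both signs outside, leaving an argument that tends to plus
     infinity. *)
  have E (n : nat) : atan ((sg * n%:R ^+ k - a) / b) =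
      sg * Num.sg b * atan ((n%:R ^+ k - sg * a) / `|b|).
    have [b1p|b1n] := ltP 0 b.
      rewrite gtr0_sg// gtr0_norm// mulr1; case: sg1 => ->; first by rewrite !mul1r.
      by rewrite !mulN1r -atanN opprK; congr atan; field.
    have {}b1n : b < 0 by rewrite lt_neqAle b0.
    rewrite ltr0_sg// ltr0_norm// mulrN1; case: sg1 => ->.
      by rewrite !mul1r mulN1r -atanN; congr atan; field.
    by rewrite opprK mul1r !mulN1r; congr atan; field.
  under eq_fun do rewrite E.
  apply: cvgM; first exact: cvg_cst.
  by apply: cvg_atan_affine => //; rewrite normr_gt0.
have b1n : b1 != 0 by apply: contraTneq b12 => ->; rewrite mul0r ltxx.
have b2n : b2 != 0 by apply: contraTneq b12 => ->; rewrite mulr0 ltxx.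
have sgE : Num.sg b1 = Num.sg b2.
  have := gtr0_sg b12; rewrite sgrM => h.
  by rewrite -[LHS]mulr1 -h mulrC -mulrA mulrCA -expr2 sqr_sg b1n mulr1.
rewrite -(subrr (sg * Num.sg b1 * (pi / 2))); apply: cvgB; first exact: H.
by rewrite sgE; exact: H.
Qed.

Definition ker_fun (j : nat) (A B : R[i]) (x : R) : R[i] :=
  (x ^+ j)%:C * (((x ^+ j.+1)%:C - A)^-1 * ((x ^+ j.+1)%:C - B)^-1).

(** The derivative of [ker_fun]; x^(2 j) is x^j times the x^j from differentiating x^(j+1). For j =
    0 the coefficient j cancels the term with the truncated exponent [j.-1]. *)
Definition ker_der (j : nat) (A B : R[i]) (x : R) : R[i] :=
  (j%:R * x ^+ j.-1)%:C * (((x ^+ j.+1)%:C - A)^-1 * ((x ^+ j.+1)%:C - B)^-1) -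
  (j.+1%:R * x ^+ (2 * j))%:C *
    ((((x ^+ j.+1)%:C - A) ^- 2 * ((x ^+ j.+1)%:C - B)^-1) +
     (((x ^+ j.+1)%:C - A)^-1 * ((x ^+ j.+1)%:C - B) ^- 2)).

Lemma subr_im_neq0 (A : R[i]) (s : R) : cim A != 0 -> s%:C - A != 0.
Proof.
move=> A0; apply: contra_neq A0 => /(congr1 (@cim R)).
by rewrite cimD cimN /cim/= add0r => /eqP; rewrite oppr_eq0 => /eqP.
Qed.

Lemma ccontinuous_subX (A : R[i]) (n : nat) : ccontinuous (fun x : R => (x ^+ n)%:C - A).
Proof.
apply: ccontinuousD; last exact: ccontinuous_cst.
by apply: ccontinuous_real => x; exact: exprn_continuous.
Qed.

Lemma ccontinuous_ker_fun j A B : cim A != 0 -> cim B != 0 -> ccontinuous (ker_fun j A B).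
Proof.
move=> A0 B0; apply: ccontinuousM.
  by apply: ccontinuous_real => x; exact: exprn_continuous.
by apply: ccontinuousM; apply: ccontinuousV => [x|]; first
  [exact: subr_im_neq0|exact: ccontinuous_subX].
Qed.

Lemma ccontinuous_ker_der j A B : cim A != 0 -> cim B != 0 -> ccontinuous (ker_der j A B).
Proof.
move=> A0 B0.
have cP C : cim C != 0 -> ccontinuous (fun x : R => ((x ^+ j.+1)%:C - C)^-1).
  move=> C0; apply: ccontinuousV => [x|]; first exact: subr_im_neq0.
  exact: ccontinuous_subX.
have cP2 C : cim C != 0 -> ccontinuous (fun x : R => ((x ^+ j.+1)%:C - C) ^- 2).
  move=> C0; apply: ccontinuousV => [x|]; first by rewrite expf_neq0//; exact: subr_im_neq0.
  by apply: ccontinuousX; exact: ccontinuous_subX.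
have cX (c : R) n : ccontinuous (fun x : R => (c * x ^+ n)%:C).
  apply: ccontinuous_real => x; apply: cvgM; first exact: cvg_cst.
  exact: exprn_continuous.
apply: ccontinuousD.
  apply: ccontinuousM => //; apply: ccontinuousM; exact: cP.
apply: ccontinuousN; apply: ccontinuousM => //; apply: ccontinuousD.
  exact: (ccontinuousM (cP2 A A0) (cP B B0)).
exact: (ccontinuousM (cP A A0) (cP2 B B0)).
Qed.

Lemma is_cderive_ker_fun j A B x : cim A != 0 -> cim B != 0 ->
  is_cderive (ker_fun j A B) x (ker_der j A B x).
Proof.
move=> A0 B0.
have dP C : is_cderive (fun x : R => (x ^+ j.+1)%:C - C) x ((j.+1%:R * x ^+ j)%:C).
  apply: is_cderive_eq; first apply: is_cderiveD.
  - exact: (is_cderive_real (is_derive_exprn j.+1 x)).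
  - exact: is_cderive_cst.
  - by rewrite addr0.
have nA := subr_im_neq0 (x ^+ j.+1) A0.
have nB := subr_im_neq0 (x ^+ j.+1) B0.
apply: is_cderive_eq; first apply: is_cderiveM.
- exact: (is_cderive_real (is_derive_exprn j x)).
- apply: is_cderiveM.
  + exact: (is_cderiveV nA (dP A)).
  + exact: (is_cderiveV nB (dP B)).
rewrite /ker_der.
have -> : (j.+1%:R * x ^+ (2 * j))%:C = (x ^+ j)%:C * (j.+1%:R * x ^+ j)%:C :> R[i].
  by rewrite -rmorphM mulrCA -exprD addnn mul2n.
set P := _%:C - A; set Q := _%:C - B; set u := (x ^+ j)%:C; set v := (_ * x ^+ j)%:C.
by rewrite /=; field; rewrite nA nB.
Qed.

Lemma cvg_clog_diff (k : nat) (A B : R[i]) (sg : R) : (0 < k)%N -> 0 < cim A * cim B ->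
  sg = 1 \/ sg = -1 ->
  (fun n : nat => cre (clog A (sg * n%:R ^+ k) - clog B (sg * n%:R ^+ k))) @ \oo --> (0 : R) /\
  (fun n : nat => cim (clog A (sg * n%:R ^+ k) - clog B (sg * n%:R ^+ k))) @ \oo --> (0 : R).
Proof.
move=> k0 AB sg1.
have A0 : cim A != 0 by apply: contraTneq AB => ->; rewrite mul0r ltxx.
have B0 : cim B != 0 by apply: contraTneq AB => ->; rewrite mulr0 ltxx.
have sg0 : sg != 0 by case: sg1 => ->; rewrite ?oppr_eq0 oner_eq0.
split.
  have h : (fun n : nat => 2^-1 * ((ln ((sg * n%:R ^+ k - cre A) ^+ 2 + cim A ^+ 2)
       - ln ((sg * n%:R ^+ k) ^+ 2)) - (ln ((sg * n%:R ^+ k - cre B) ^+ 2 + cim B ^+ 2)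
       - ln ((sg * n%:R ^+ k) ^+ 2)))) @ \oo --> (2^-1 * (0 - 0) : R).
    apply: cvgM; first exact: cvg_cst.
    by apply: cvgB; exact: cvg_ln_quadratic.
  rewrite subr0 mulr0 in h.
  under eq_fun => n.
    rewrite creD creN /clog /cre/=.
    rewrite (_ : _ - _ = 2^-1 * ((ln ((sg * n%:R ^+ k - cre A) ^+ 2 + cim A ^+ 2)
       - ln ((sg * n%:R ^+ k) ^+ 2)) - (ln ((sg * n%:R ^+ k - cre B) ^+ 2 + cim B ^+ 2)
       - ln ((sg * n%:R ^+ k) ^+ 2)))); last by rewrite /cre; ring.
    over.
  exact: h.
under eq_fun do rewrite cimD cimN /clog [X in X - _]/cim [X in _ - X]/cim/=.
exact: cvg_atan_diff.
Qed.

(* Both poles lie on the same side of the real axis, so the logarithmic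
   primitive of the partial fraction decomposition tends to [0] at both ends. *)
Lemma cintegral_ker_fun (j : nat) (A B : R[i]) : ~~ odd j -> 0 < cim A * cim B -> A != B ->
  cintegrable mu (ker_fun j A B) -> cintegral mu (ker_fun j A B) = 0.
Proof.
move=> jeven AB0 AB iker.
have A0 : cim A != 0 by apply: contraTneq AB0 => ->; rewrite mul0r ltxx.
have B0 : cim B != 0 by apply: contraTneq AB0 => ->; rewrite mulr0 ltxx.
pose c : R[i] := (j.+1%:R * (A - B))^-1.
pose L x := clog A (x ^+ j.+1) - clog B (x ^+ j.+1).
have c0 : j.+1%:R * (A - B) != 0 by rewrite mulf_neq0 ?subr_eq0// pnatr_eq0.
have dG x : is_cderive (fun x => c * L x) x (ker_fun j A B x).
  apply: is_cderive_eq; first apply: is_cderiveM.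
  - exact: is_cderive_cst.
  - apply: is_cderiveD; first exact: (is_cderive_clog j x A0).
    by apply: is_cderiveN; exact: (is_cderive_clog j x B0).
  rewrite mul0r add0r /c /ker_fun rmorphM/=.
  have -> : (j.+1%:R : R)%:C = j.+1%:R :> R[i] by rewrite rmorph_nat.
  have nA := subr_im_neq0 (x ^+ j.+1) A0.
  have nB := subr_im_neq0 (x ^+ j.+1) B0.
  set P := _%:C in nA nB *.
  field.
  by rewrite nA nB subr_eq0 AB/= addrC natr1 pnatr_eq0.
have cg := ccontinuous_ker_fun j A0 B0.
have Lp : forall sg : R, sg = 1 \/ sg = -1 ->
    (fun n : nat => cre (c * L (sg * n%:R))) @ \oo --> (0 : R) /\
    (fun n : nat => cim (c * L (sg * n%:R))) @ \oo --> (0 : R).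
  move=> sg sg1.
  (* As j is even, x |-> x^(j+1) sends the two ends of the line to the two corresponding ends, so
     [cvg_clog_diff] applies with the same sign. *)
  have sgX : sg ^+ j.+1 = sg.
    case: sg1 => ->; first by rewrite expr1n.
    by rewrite -signr_odd /= jeven expr1.
  have [h1 h2] := @cvg_clog_diff j.+1 A B sg isT AB0 sg1.
  split.
    under eq_fun do rewrite creM /L exprMn sgX.
    have h : (fun n : nat => cre c * cre (clog A (sg * n%:R ^+ j.+1) - clog B (sg * n%:R ^+ j.+1))
        - cim c * cim (clog A (sg * n%:R ^+ j.+1) - clog B (sg * n%:R ^+ j.+1))) @ \oo
        --> (cre c * 0 - cim c * 0).
      by apply: cvgB; apply: cvgM; first [exact: cvg_cst|exact: h1|exact: h2].
    by rewrite !mulr0 subr0 in h.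
  under eq_fun do rewrite cimM /L exprMn sgX.
  have h : (fun n : nat => cre c * cim (clog A (sg * n%:R ^+ j.+1) - clog B (sg * n%:R ^+ j.+1))
      + cim c * cre (clog A (sg * n%:R ^+ j.+1) - clog B (sg * n%:R ^+ j.+1))) @ \oo
      --> (cre c * 0 + cim c * 0).
    by apply: cvgD; apply: cvgM; first [exact: cvg_cst|exact: h1|exact: h2].
  by rewrite !mulr0 addr0 in h.
have [p1 p2] := Lp 1 (or_introl erefl).
have [m1 m2] := Lp (-1) (or_intror erefl).
case: cg => c1 c2; case: iker => i1 i2.
have E1 : Rintegral mu setT (fun x => cre (ker_fun j A B x)) = 0.
  apply: (@Rintegral_derive_eq0 _ (fun x => cre (c * L x))) => //.
    exact: (fun x => proj1 (dG x)).
  rewrite -[X in _ --> X](subrr 0); apply: cvgB.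
    by under eq_fun do rewrite -[_%:R]mul1r.
  by under eq_fun do rewrite -mulN1r.
have E2 : Rintegral mu setT (fun x => cim (ker_fun j A B x)) = 0.
  apply: (@Rintegral_derive_eq0 _ (fun x => cim (c * L x))) => //.
    exact: (fun x => proj2 (dG x)).
  rewrite -[X in _ --> X](subrr 0); apply: cvgB.
    by under eq_fun do rewrite -[_%:R]mul1r.
  by under eq_fun do rewrite -mulN1r.
by rewrite /cintegral E1 E2.
Qed.

End Vanishing.

(** * Transform of the kernel at fixed [eta], with [V] standing for |eta|^(i+1) *)

Section KernelBounds.
Context {R : realType}.
Notation mu := (@lebesgue_measure R).
Variables (j : nat) (A B : R[i]) (V dl : R).
Hypotheses (V0 : 0 < V) (dl0 : 0 < dl) (AB0 : 0 < cim A * cim B) (AB : A != B).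
Hypothesis jeven : ~~ odd j.
Hypothesis HA : forall x : R, dl * (`|x| ^+ j.+1 + V) <= cabs ((x ^+ j.+1)%:C - A).
Hypothesis HB : forall x : R, dl * (`|x| ^+ j.+1 + V) <= cabs ((x ^+ j.+1)%:C - B).

Let A0 : cim A != 0. Proof. by apply: contraTneq AB0 => ->; rewrite mul0r ltxx. Qed.
Let B0 : cim B != 0. Proof. by apply: contraTneq AB0 => ->; rewrite mulr0 ltxx. Qed.
Let D (x : R) := `|x| ^+ j.+1 + V.
Let D0 x : 0 < D x. Proof. by rewrite ltr_wpDl// exprn_ge0. Qed.
Let VA x : (cabs ((x ^+ j.+1)%:C - A))^-1 <= dl^-1 * (D x)^-1.
Proof.
have h0 : 0 < dl * D x by rewrite mulr_gt0.
have h1 := lt_le_trans h0 (HA x).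
by rewrite -invfM lef_pV2 ?posrE//; exact: HA.
Qed.
Let VB x : (cabs ((x ^+ j.+1)%:C - B))^-1 <= dl^-1 * (D x)^-1.
Proof.
have h0 : 0 < dl * D x by rewrite mulr_gt0.
have h1 := lt_le_trans h0 (HB x).
by rewrite -invfM lef_pV2 ?posrE//; exact: HB.
Qed.
Let dlV n : 0 <= dl ^- n. Proof. by rewrite invr_ge0 exprn_ge0// ltW. Qed.
Let V_ge0 (z : R[i]) : 0 <= (cabs z)^-1. Proof. by rewrite invr_ge0 cabs_ge0. Qed.

Lemma ker_fun_le x : cabs (ker_fun j A B x) <= dl ^- 2 * (`|x| ^+ j / D x ^+ 2).
Proof.
rewrite /ker_fun !cabsM !cabsV cabsR normrX.
have h := ler_pM (V_ge0 _) (V_ge0 _) (VA x) (VB x).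
apply: le_trans (ler_wpM2l (exprn_ge0 j (normr_ge0 x)) h) _.
rewrite le_eqVlt; apply/orP; left; apply/eqP; field.
by rewrite !gt_eqF.
Qed.

Lemma ker_der_le x : cabs (ker_der j A B x) <=
  dl ^- 2 * (j%:R * (`|x| ^+ j.-1 / D x ^+ 2)) +
  2 * j.+1%:R * dl ^- 3 * (`|x| ^+ (2 * j) / D x ^+ 3).
Proof.
apply: le_trans (cabsB _ _) _; apply: lerD.
  rewrite !cabsM !cabsV cabsR normrM normrX normr_nat.
  have h := ler_pM (V_ge0 _) (V_ge0 _) (VA x) (VB x).
  have h0 : 0 <= j%:R * `|x| ^+ j.-1 by rewrite mulr_ge0// exprn_ge0.
  apply: le_trans (ler_wpM2l h0 h) _.
  rewrite le_eqVlt; apply/orP; left; apply/eqP; field.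
  by rewrite !gt_eqF.
rewrite cabsM cabsR normrM normrX normr_nat.
set v := (dl * D x)^-1.
have E : dl ^- 3 * D x ^- 3 = v ^+ 3.
  by rewrite /v; field; rewrite !gt_eqF.
rewrite [leRHS](_ : _ = j.+1%:R * `|x| ^+ (2 * j) * (v ^+ 3 + v ^+ 3)); last by rewrite -E; ring.
rewrite ler_wpM2l ?mulr_ge0 ?exprn_ge0//.
have vA : (cabs ((x ^+ j.+1)%:C - A))^-1 <= v by rewrite /v invfM; exact: VA.
have vB : (cabs ((x ^+ j.+1)%:C - B))^-1 <= v by rewrite /v invfM; exact: VB.
have v0 : 0 <= v by rewrite invr_ge0 mulr_ge0 ?ltW.
apply: le_trans (cabsD _ _) _; rewrite !cabsM !cabsV !cabsX -!exprVn; apply: lerD.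
  by rewrite (exprSr v 2) ler_pM ?exprn_ge0// lerXn2r ?nnegrE.
by rewrite (exprS v 2) ler_pM ?exprn_ge0// lerXn2r ?nnegrE.
Qed.

(** Here and in [ker_der_dominated] the constant depends on [V] and degenerates as [V] tends to 0.
    These bounds only give integrability and vanishing boundary terms; the estimates rest on
    [ker_fun_le] and [ker_der_le]. *)
Lemma ker_fun_dominated : exists2 C : R, 0 <= C & forall x, cabs (ker_fun j A B x) <= C / (1 + x ^+ 2).
Proof.
exists (dl ^- 2 * (2 / V ^+ 2 + 2)).
  by rewrite mulr_ge0 ?addr_ge0 ?invr_ge0 ?exprn_ge0 ?divr_ge0 ?exprn_ge0 ?ltW.
move=> x; apply: le_trans (ker_fun_le x) _; rewrite -mulrA ler_wpM2l//.
by rewrite -(real_normK (num_real x)); apply: le_pow_oneDsqrV => //; lia.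
Qed.

Lemma ker_der_dominated : exists2 C : R, 0 <= C & forall x, cabs (ker_der j A B x) <= C / (1 + x ^+ 2).
Proof.
have V2 q : 0 <= 2 / V ^+ q + 2 by rewrite addr_ge0// divr_ge0// exprn_ge0// ltW.
exists (dl ^- 2 * (j%:R * (2 / V ^+ 2 + 2)) + 2 * j.+1%:R * dl ^- 3 * (2 / V ^+ 3 + 2)).
  by rewrite addr_ge0// !mulr_ge0.
move=> x; apply: le_trans (ker_der_le x) _; rewrite [leRHS]mulrDl.
rewrite -(real_normK (num_real x)); apply: lerD.
  rewrite -mulrA -mulrA ler_wpM2l//.
  have [->|jp] := posnP j; first by rewrite !mul0r.
  rewrite ler_wpM2l//; apply: le_pow_oneDsqrV => //; lia.
rewrite -[leRHS]mulrA ler_wpM2l ?mulr_ge0//.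
by apply: le_pow_oneDsqrV => //; lia.
Qed.

Lemma cintegrable_ker_fun : cintegrable mu (ker_fun j A B).
Proof.
have [C _ h] := ker_fun_dominated; apply: le_cintegrable_oneDsqrV h.
by apply: ccontinuous_measurable; exact: ccontinuous_ker_fun.
Qed.

(** The factor - 2 pi of the transform is absorbed into c, which later becomes - 2 pi (p.1 -
    p'.1). *)
Definition ker_hat (c : R) := cintegral mu (fun x => ker_fun j A B x * expi (c * x)).

Let ccont_expi c : ccontinuous (fun x : R => expi (c * x)).
Proof. by apply: ccontinuous_expi => x; apply: cvgM; [exact: cvg_cst|exact: cvg_id]. Qed.

Lemma cintegrable_ker_expi c : cintegrable mu (fun x => ker_fun j A B x * expi (c * x)).
Proof.
have [C _ h] := ker_fun_dominated; apply: (@le_cintegrable_oneDsqrV _ C).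
  apply: ccontinuous_measurable; apply: ccontinuousM; first exact: ccontinuous_ker_fun.
  exact: ccont_expi.
by move=> x; rewrite cabsM cabs_expi mulr1.
Qed.

(** Because the kernel has zero integral, [expi (c * x)] may be replaced by [expi (c * x) - 1];
    [cabs_expi_sub1] supplies the factor 2 and the minimum. *)
Lemma ker_hat_le_near c : ((cabs (ker_hat c))%:E <=
  \int[mu]_x (2 * dl ^- 2 * (Num.min 1 `|c * x| * `|x| ^+ j / D x ^+ 2))%:E)%E.
Proof.
have -> : ker_hat c = cintegral mu (fun x => ker_fun j A B x * (expi (c * x) - 1)).
  transitivity (ker_hat c + (-1) * cintegral mu (ker_fun j A B)).
    by rewrite cintegral_ker_fun// ?mulr0 ?addr0//; exact: cintegrable_ker_fun.
  rewrite -cintegralM; last exact: cintegrable_ker_fun.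
  rewrite -cintegralD; last 2 first.
  - exact: cintegrable_ker_expi.
  - by apply: cintegrableM; exact: cintegrable_ker_fun.
  by apply: eq_cintegral => x; rewrite mulrBr mulr1 mulN1r.
have mF : cmeasurable (fun x => ker_fun j A B x * (expi (c * x) - 1)).
  apply: ccontinuous_measurable; apply: ccontinuousM; first exact: ccontinuous_ker_fun.
  by apply: ccontinuousD; [exact: ccont_expi|exact: ccontinuous_cst].
apply: le_trans (cabs_cintegral_le mu mF) _.
apply: ge0_le_integral => //.
- by move=> x _; rewrite lee_fin cabs_ge0.
- by apply/measurable_EFinP; exact: measurable_cabs.
- apply/measurable_EFinP.
  have mX n : measurable_fun setT (fun x : R => `|x| ^+ n) by apply: measurable_funX; exact: normr_measurable.
  have mD n : measurable_fun setT (fun x : R => D x ^- n).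
    by apply: (measurableT_comp measurable_invr); apply: measurable_funX; exact: measurable_funD.
  have mm : measurable_fun setT ((fun _ : R => (1 : R)) \min (fun x : R => `|c * x|)).
    apply: measurable_minr => //.
    by apply: measurableT_comp => //; exact: measurable_funM.
  exact: (measurable_funM (measurable_cst _) (measurable_funM (measurable_funM mm (mX j)) (mD 2))).
- move=> x _; rewrite lee_fin cabsM.
  apply: le_trans (ler_pM _ _ (ker_fun_le x) (cabs_expi_sub1 _)) _; rewrite ?cabs_ge0//.
  by rewrite le_eqVlt; apply/orP; left; apply/eqP; ring.
Qed.

(** The derivative of kernel times exponential integrates to zero, so i c times the transform is
    minus the transform of [ker_der]; this is the source of |c|^-1. *)
Lemma ker_hat_le_far c : c != 0 -> ((cabs (ker_hat c))%:E <=
  \int[mu]_x (`|c|^-1 * (dl ^- 2 * (j%:R * (`|x| ^+ j.-1 / D x ^+ 2)) +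
  2 * j.+1%:R * dl ^- 3 * (`|x| ^+ (2 * j) / D x ^+ 3)))%:E)%E.
Proof.
move=> c0; have ci0 : 0 +i* c != 0 by rewrite eq_complex /= eqxx.
have cci : cabs (0 +i* c) = `|c| by rewrite /cabs/cre/cim/= expr0n/= add0r sqrtr_sqr.
have [C C0 hC] := ker_fun_dominated; have [C' C'0 hC'] := ker_der_dominated.
have cd : ccontinuous (fun x => ker_der j A B x * expi (c * x)).
  by apply: ccontinuousM; [exact: ccontinuous_ker_der|exact: ccont_expi].
have id' : cintegrable mu (fun x => ker_der j A B x * expi (c * x)).
  apply: (@le_cintegrable_oneDsqrV _ C'); first exact: ccontinuous_measurable.
  by move=> x; rewrite cabsM cabs_expi mulr1.
have H : cintegral mu (fun x => ker_der j A B x * expi (c * x)) + (0 +i* c) * ker_hat c = 0.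
  rewrite -cintegralM; last exact: cintegrable_ker_expi.
  rewrite -cintegralD//; last by apply: cintegrableM; exact: cintegrable_ker_expi.
  (* One constant has to dominate both the product, bounded with C, and its derivative, bounded with
     C' + |c| C. *)
  apply: (@cintegral_cderive_eq0 _ (C + C' + `|c| * C) (fun x => ker_fun j A B x * expi (c * x))).
  - move=> x; apply: is_cderive_eq; first apply: is_cderiveM.
    + exact: (is_cderive_ker_fun j x A0 B0).
    + exact: is_cderive_expi.
    + by rewrite /= mulrCA.
  - apply: ccontinuousD => //; apply: ccontinuousM; first exact: ccontinuous_cst.
    by apply: ccontinuousM; [exact: ccontinuous_ker_fun|exact: ccont_expi].
  - move=> x; rewrite cabsM cabs_expi mulr1; apply: le_trans (hC x) _.
    rewrite ler_wpM2r ?invr_ge0 ?addr_ge0 ?sqr_ge0//.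
    by rewrite -addrA lerDl addr_ge0// mulr_ge0.
  - move=> x; apply: le_trans (cabsD _ _) _.
    rewrite (cabsM (ker_der j A B x)) (cabsM (0 +i* c)) (cabsM (ker_fun j A B x)) cabs_expi !mulr1 cci.
    rewrite [leRHS]mulrDl [X in _ <= X + _]mulrDl; have := hC x; have := hC' x.
    have h0 : 0 <= C / (1 + x ^+ 2) by rewrite divr_ge0// addr_ge0// sqr_ge0.
    move=> h1 h2.
    have h3 : `|c| * cabs (ker_fun j A B x) <= `|c| * C / (1 + x ^+ 2).
      by rewrite -mulrA ler_wpM2l.
    lra.
have E : ker_hat c = - (0 +i* c)^-1 * cintegral mu (fun x => ker_der j A B x * expi (c * x)).
  move/eqP: H; rewrite addr_eq0 => /eqP ->.
  by rewrite mulrNN mulrA mulVf// mul1r.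
rewrite E -cintegralM//.
have mF : cmeasurable (fun x => - (0 +i* c)^-1 * (ker_der j A B x * expi (c * x))).
  by apply: ccontinuous_measurable; apply: ccontinuousM => //; exact: ccontinuous_cst.
apply: le_trans (cabs_cintegral_le mu mF) _.
apply: ge0_le_integral => //.
- by move=> x _; rewrite lee_fin cabs_ge0.
- by apply/measurable_EFinP; exact: measurable_cabs.
- apply/measurable_EFinP.
  have mX n : measurable_fun setT (fun x : R => `|x| ^+ n) by apply: measurable_funX; exact: normr_measurable.
  have mD n : measurable_fun setT (fun x : R => D x ^- n).
    by apply: (measurableT_comp measurable_invr); apply: measurable_funX; exact: measurable_funD.
  exact: (measurable_funM (measurable_cst _) (measurable_funD
    (measurable_funM (measurable_cst _) (measurable_funM (measurable_cst _)
      (measurable_funM (mX _) (mD 2))))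
    (measurable_funM (measurable_cst _) (measurable_funM (mX _) (mD 3))))).
- move=> x _; rewrite lee_fin (cabsM (- _)) (cabsM (ker_der j A B x)) cabs_expi mulr1 cabsN cabsV cci.
  by rewrite ler_wpM2l ?invr_ge0//; exact: ker_der_le.
Qed.

End KernelBounds.

(** * Explicit integrals in [eta], with [A] standing for |xi|^(j+1) *)

Section RadialIntegrals.
Context {R : realType}.
Notation mu := (@lebesgue_measure R).
Variables (i : nat) (A : R).
Let h (x : R) : R := `|x| ^+ i / (A + `|x| ^+ i.+1) ^+ 2.
(** The power |x|^i in [h] is, up to a constant, the derivative of x^(i+1) for x > 0, hence this
    elementary primitive on the positive half-line. *)
Let F (x : R) : R := - (i.+1%:R^-1 * (A + x ^+ i.+1)^-1).

Let hN x : h (- x) = h x. Proof. by rewrite /h normrN. Qed.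

Let h_ge0 x : 0 <= h x.
Proof. by apply: divr_ge0; [exact: exprn_ge0|exact: sqr_ge0]. Qed.

Let derF (x : R) : 0 < x -> 0 <= A -> is_derive x 1 F (h x).
Proof.
move=> x0 A0; have p0 : A + x ^+ i.+1 != 0 by rewrite gt_eqF// ltr_wpDl// exprn_gt0.
have d1 : is_derive x 1 (fun t : R => A + t ^+ i.+1) (i.+1%:R * x ^+ i).
  by apply: (is_derive_val (is_deriveDf (is_derive_cst A x 1) (is_derive_exprn i.+1 x))); rewrite add0r.
have d2 := is_deriveNf (is_deriveMf (is_derive_cst (i.+1%:R^-1 : R) x 1) (@is_deriveV _ (fun t : R => A + t ^+ i.+1) x _ 1 p0 d1)).
apply: (is_derive_val d2); rewrite /h gtr0_norm// /cst mulr0 addr0 /GRing.scale/=.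
field; rewrite p0/=.
by rewrite addrC natr1 pnatr_eq0.
Qed.

Let cont_h (x : R) : 0 < A + `|x| ^+ i.+1 -> {for x, continuous h}.
Proof.
move=> p0.
have cX n : {for x, continuous (fun t : R => `|t| ^+ n)}.
  apply: (@continuous_comp _ _ _ (fun t : R => `|t|) (fun t => t ^+ n)).
    exact: norm_continuous.
  exact: exprn_continuous.
apply: cvgM; first exact: cX.
apply: cvgV; first by rewrite expf_neq0// gt_eqF.
rewrite !expr2; under eq_fun do rewrite expr2.
by apply: cvgM; apply: cvgD; first [exact: cvg_cst|exact: cX].
Qed.

(** The right-hand side is twice F(r) - F(0), by evenness. Positivity of A matters: for A = 0 the
    integrand behaves like |x|^(-i-2) at 0. *)
Lemma integral_radial_near (r : R) : 0 < A -> 0 < r ->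
  (\int[mu]_x (if `|x| < r then h x else 0)%:E <=
   (2 / i.+1%:R * (r ^+ i.+1 / (A * (A + r ^+ i.+1))))%:E)%E.
Proof.
move=> A0 r0.
have ch : continuous h by move=> x; apply: cont_h; rewrite ltr_pwDl// exprn_ge0.
have mh : measurable_fun setT h by exact: continuous_measurable_fun.
have mhE : measurable_fun setT (EFin \o h) by exact/measurable_EFinP.
have mr (D : set R) : measurable D -> measurable_fun setT ((EFin \o h) \_ D).
  move=> mD; apply/(measurable_restrictT _ mD).
  exact: (measurable_funS measurableT (@subsetT _ _) mhE).
have I1 : (\int[mu]_(x in `[0%R, r]) (h x)%:E = (F r)%:E - (F 0)%:E)%E.
  apply: continuous_FTC2 => //.
  - exact: continuous_subspaceT.
  - have cF x : 0 <= x -> {for x, continuous F}.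
      move=> x0; apply: cvgN; apply: cvgM; first exact: cvg_cst.
      apply: cvgV; first by rewrite gt_eqF// ltr_pwDl// exprn_ge0.
      by apply: cvgD; [exact: cvg_cst|exact: exprn_continuous].
    split.
    + by move=> x; rewrite in_itv/= => /andP[x0 _]; have [] := derF x0 (ltW A0).
    + by apply: cvg_at_right_filter; exact: cF.
    + by apply: cvg_at_left_filter; apply: cF; exact: ltW.
  - move=> x; rewrite in_itv/= => /andP[x0 _]; rewrite derive1E.
    by have hd := derF x0 (ltW A0); exact: derive_val.
have I2 : (\int[mu]_(x in `[(- r)%R, 0%R]) (h x)%:E = (F r)%:E - (F 0)%:E)%E.
  rewrite -I1 -[X in `[_, X]]oppr0 integration_by_substitution_oppr//.
  - by apply: eq_integral => x _ /=; rewrite hN.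
  - exact: ltW.
  - exact: continuous_subspaceT.
(* Only an upper bound is wanted, so the two closed halves may overlap at 0 and contain the
   endpoints. *)
apply: (@le_trans _ _ (\int[mu]_x (((EFin \o h) \_ `[(- r)%R, 0%R]) x
     + ((EFin \o h) \_ `[0%R, r]) x))%E).
  apply: ge0_le_integral => //.
  - by move=> x _; case: ifP => // _; rewrite lee_fin.
  - apply/measurable_EFinP; apply: measurable_fun_ifT => //.
    by apply: measurable_fun_ltr => //; exact: normr_measurable.
  - apply: emeasurable_funD.
      exact: mr.
    exact: mr.
  - move=> x _; rewrite !patchE; case: ifPn => [|_]; last first.
      by apply: adde_ge0; case: ifP => // _; rewrite lee_fin.
    rewrite ltr_norml => /andP[x1 x2].
    have [x0|x0] := leP 0 x.
      rewrite [X in (_ + X)%E]ifT; last by rewrite inE/= in_itv/= x0 ltW.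
      by rewrite leeDr//; case: ifP => // _; rewrite lee_fin.
    rewrite [X in (X + _)%E]ifT; last by rewrite inE/= in_itv/= !ltW.
    by rewrite leeDl//; case: ifP => // _; rewrite lee_fin.
rewrite ge0_integralD//; last 4 first.
- by move=> x _; rewrite patchE; case: ifP => // _; rewrite lee_fin.
- exact: mr.
- by move=> x _; rewrite patchE; case: ifP => // _; rewrite lee_fin.
- exact: mr.
rewrite -!integral_mkcond I1 I2 -!EFinB -EFinD lee_fin /F expr0n/= addr0.
have Ar : A + r ^+ i.+1 != 0 by rewrite gt_eqF// ltr_pwDl// exprn_ge0// ltW.
rewrite le_eqVlt; apply/orP; left; apply/eqP; field.
by rewrite Ar gt_eqF//= addrC natr1 pnatr_eq0.
Qed.

(** The right-hand side is - 2 F(r), since F vanishes at infinity. The origin is cut off, so A = 0,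
    that is xi = 0, is admissible here. *)
Lemma integral_radial_far (r : R) : 0 <= A -> 0 < r ->
  (\int[mu]_x (if `|x| < r then 0 else h x)%:E <=
   (2 / i.+1%:R / (A + r ^+ i.+1))%:E)%E.
Proof.
move=> A0 r0.
have ch x : x != 0 -> {for x, continuous h}.
  by move=> x0; apply: cont_h; rewrite ltr_wpDl// exprn_gt0// normr_gt0.
have chy : {within `[r, +oo[, continuous h}.
  apply: continuous_in_subspaceT => x; rewrite inE/= in_itv/= andbT => rx.
  by apply: ch; rewrite gt_eqF// (lt_le_trans r0).
have chNy : {within `]-oo, (- r)%R], continuous h}.
  apply: continuous_in_subspaceT => x; rewrite inE/= in_itv/= => rx.
  by apply: ch; rewrite lt_eqF// (le_lt_trans rx)// oppr_lt0.
have mh : measurable_fun setT h.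
  have mX n : measurable_fun setT (fun x : R => `|x| ^+ n) by apply: measurable_funX; exact: normr_measurable.
  apply: measurable_funM => //; apply: (measurableT_comp measurable_invr).
  by apply: measurable_funX; exact: measurable_funD.
have mhE : measurable_fun setT (EFin \o h) by exact/measurable_EFinP.
have mr (D : set R) : measurable D -> measurable_fun setT ((EFin \o h) \_ D).
  move=> mD; apply/(measurable_restrictT _ mD).
  exact: (measurable_funS measurableT (@subsetT _ _) mhE).
have I1 : (\int[mu]_(x in `[r, +oo[) (h x)%:E = 0%:E - (F r)%:E)%E.
  apply: ge0_continuous_FTC2y => //.
  - rewrite /F -[X in _ --> X]oppr0; apply: cvgN.
    rewrite -[X in _ --> X](mulr0 i.+1%:R^-1); apply: cvgM; first exact: cvg_cst.
    apply/cvgr0Pnorm_le => e e0; near=> x.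
    have x1 : 1 <= x by near: x; exact: nbhs_pinfty_ge.
    have p0 : 0 < A + x ^+ i.+1 by rewrite ltr_wpDl// exprn_gt0// (lt_le_trans ltr01).
    rewrite gtr0_norm ?invr_gt0// invf_ple ?posrE//.
    apply: (@le_trans _ _ x); first by near: x; apply: nbhs_pinfty_ge; exact: num_real.
    by apply: ler_wpDl => //; rewrite -[leLHS]expr1 ler_weXn2l.
  - by move=> x rx; have [] := derF (lt_trans r0 rx) A0.
  - apply: cvg_at_right_filter; apply/differentiable_continuous/derivable1_diffP.
    by have [] := derF r0 A0.
  - move=> x; rewrite in_itv/= andbT => rx; rewrite derive1E.
    by have hd := derF (lt_trans r0 rx) A0; exact: derive_val.
have I2 : (\int[mu]_(x in `]-oo, (- r)%R]) (h x)%:E = 0%:E - (F r)%:E)%E.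
  rewrite -I1 ge0_integration_by_substitutionNy//.
  by apply: eq_integral => x _ /=; rewrite hN.
apply: (@le_trans _ _ (\int[mu]_x (((EFin \o h) \_ `]-oo, (- r)%R]) x
     + ((EFin \o h) \_ `[r, +oo[) x))%E).
  apply: ge0_le_integral => //.
  - by move=> x _; case: ifP => // _; rewrite lee_fin.
  - apply/measurable_EFinP; apply: measurable_fun_ifT => //.
    by apply: measurable_fun_ltr => //; exact: normr_measurable.
  - apply: emeasurable_funD.
      exact: mr.
    exact: mr.
  - move=> x _; rewrite !patchE; case: ifPn => [_|].
      by apply: adde_ge0; case: ifP => // _; rewrite lee_fin.
    rewrite -leNgt => x1.
    have [x0|x0] := leP 0 x.
      rewrite [X in (_ + X)%E]ifT; last by rewrite inE/= in_itv/= andbT -(ger0_norm x0).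
      by rewrite leeDr//; case: ifP => // _; rewrite lee_fin.
    rewrite [X in (X + _)%E]ifT; last by rewrite inE/= in_itv/= lerNr -(ltr0_norm x0).
    by rewrite leeDl//; case: ifP => // _; rewrite lee_fin.
rewrite ge0_integralD//; last 4 first.
- by move=> x _; rewrite patchE; case: ifP => // _; rewrite lee_fin.
- exact: mr.
- by move=> x _; rewrite patchE; case: ifP => // _; rewrite lee_fin.
- exact: mr.
rewrite -!integral_mkcond I1 I2 -!EFinB -EFinD lee_fin /F.
by rewrite sub0r opprK le_eqVlt; apply/orP; left; apply/eqP; ring.
Unshelve. all: by end_near. Qed.

End RadialIntegrals.

(** The primitive is atan (|c| x), whose total variation does not depend on the scale c; for c = 0
    the integrand is zero. *)
Lemma integral_scaled_oneDsqrV {R : realType} (c : R) :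
  (\int[@lebesgue_measure R]_x (`|c| / (1 + (c * x) ^+ 2))%:E <= (pi : R)%:E)%E.
Proof.
have [->|c0] := eqVneq c 0.
  under eq_integral => x _ do rewrite normr0 mul0r.
  by rewrite integral0 lee_fin pi_ge0.
have n0 : 0 < `|c| by rewrite normr_gt0.
have q0 (x : R) : 0 < 1 + (c * x) ^+ 2 by rewrite ltr_pwDl// sqr_ge0.
have cf : continuous (fun x : R => `|c| / (1 + (c * x) ^+ 2)).
  move=> x; apply: cvgM; first exact: cvg_cst.
  apply: cvgV; first by rewrite gt_eqF.
  apply: cvgD; first exact: cvg_cst.
  apply: (@continuous_comp _ _ _ (fun t : R => c * t) (fun t => t ^+ 2)).
    by apply: cvgM; [exact: cvg_cst|exact: cvg_id].
  exact: exprn_continuous.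
have dat (x : R) : is_derive x 1 (fun x : R => atan (`|c| * x)) (`|c| / (1 + (c * x) ^+ 2)).
  have d1 : is_derive x 1 (fun t : R => `|c| * t) `|c|.
    apply: (is_derive_val (is_deriveMf (is_derive_cst `|c| x 1) (is_derive_id x 1))).
    by rewrite /cst mulr1 mulr0 addr0.
  have d2 := @is_derive_compf _ (@atan R) (fun t : R => `|c| * t) _ _ _ (is_derive1_atan (`|c| * x)) d1.
  by apply: (is_derive_val d2); rewrite !exprMn real_normK ?num_real// mulrC.
rewrite ge0_symfun_integralT//; last 2 first.
- by move=> x; rewrite divr_ge0// ltW.
- by move=> x /=; rewrite mulrN sqrrN.
rewrite -set_itvcy (@ge0_continuous_FTC2y _ _ (fun x => atan (`|c| * x)) 0 (pi / 2)).
- by rewrite mulr0 atan0 sube0 -EFinM lee_fin mulrC divfK.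
- by move=> x _; rewrite divr_ge0// ltW.
- exact: continuous_subspaceT.
- apply: (@cvg_comp _ _ _ (fun x : R => `|c| * x) atan _ (pinfty_nbhs R)); last exact: cvgy_atan.
  apply/cvgryPge => M; near=> x; rewrite -ler_pdivrMl//.
- by move=> x _; have [] := dat x.
- apply: cvg_at_right_filter; apply/differentiable_continuous/derivable1_diffP.
  by have [] := dat 0.
- move=> x _; rewrite derive1E.
  by have hd := dat x; exact: derive_val.
Unshelve. all: by end_near. Qed.

(** * The positive majorant and its integral, uniformly in the frequency *)

Section Majorant.
Context {R : realType}.
Notation mu := (@lebesgue_measure R).

Definition wnear (j : nat) (c x : R) : R := Num.min 1 `|c * x| * `|x| ^+ j.

(** Comes from [ker_der_le], with D = |x|^(j+1) + |eta|^(i+1). In the term carrying D^-3, one factor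
    1 / D is traded for |c|^(j+1) / (|c x|^(j+1) + 1), which is free of eta, so the weight in eta is
    |eta|^i / D^2 in every term. *)
Definition wfar (j : nat) (c x : R) : R :=
  (`|c| ^+ j)^-1 *
  (j%:R * `|c * x| ^+ j.-1 + `|c * x| ^+ (2 * j) / (`|c * x| ^+ j.+1 + 1)).

(** The test is |c| |eta|^(l/k) < 1 raised to the power k, which avoids fractional powers. Both
    regimes share the weight integrated by [integral_radial_near] and [integral_radial_far]. *)
Definition wker (j i : nat) (c eta xi : R) : R :=
  (if `|eta| ^+ i.+1 * `|c| ^+ j.+1 < 1 then wnear j c xi else wfar j c xi) *
  (`|eta| ^+ i / (`|xi| ^+ j.+1 + `|eta| ^+ i.+1) ^+ 2).

Lemma wnear_ge0 j c x : 0 <= wnear j c x.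
Proof. by rewrite mulr_ge0 ?exprn_ge0// le_min ler01 normr_ge0. Qed.

Lemma wfar_ge0 j c x : 0 <= wfar j c x.
Proof.
by rewrite mulr_ge0 ?invr_ge0 ?exprn_ge0// addr_ge0 ?mulr_ge0 ?exprn_ge0// invr_ge0 addr_ge0// exprn_ge0.
Qed.

Lemma wker_ge0 j i c eta xi : 0 <= wker j i c eta xi.
Proof.
apply: mulr_ge0; first by case: ifP => _; [exact: wnear_ge0|exact: wfar_ge0].
by apply: divr_ge0; [exact: exprn_ge0|exact: sqr_ge0].
Qed.

Lemma measurable_wker {d : measure_display} {T : measurableType d} j i (c eta xi : T -> R) :
  measurable_fun setT c -> measurable_fun setT eta -> measurable_fun setT xi ->
  measurable_fun setT (fun p => wker j i (c p) (eta p) (xi p)).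
Proof.
move=> mc me mx.
have mN (u : T -> R) n : measurable_fun setT u -> measurable_fun setT (fun p => `|u p| ^+ n).
  by move=> mu'; apply: measurable_funX; exact: measurableT_comp.
have mV (u : T -> R) : measurable_fun setT u -> measurable_fun setT (fun p => (u p)^-1).
  by move=> mu'; exact: (measurableT_comp measurable_invr).
have mcx : measurable_fun setT (fun p => c p * xi p) by exact: measurable_funM.
have mn : measurable_fun setT (fun p => wnear j (c p) (xi p)).
  have mm : measurable_fun setT ((fun _ : T => (1 : R)) \min (fun p => `|c p * xi p|)).
    by apply: measurable_minr => //; exact: measurableT_comp.
  exact: (measurable_funM mm (mN _ j mx)).
have mf : measurable_fun setT (fun p => wfar j (c p) (xi p)).
  apply: measurable_funM; first by apply: mV; exact: mN.
  apply: measurable_funD; first by apply: measurable_funM => //; exact: mN.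
  apply: measurable_funM; first exact: mN.
  by apply: mV; apply: measurable_funD => //; exact: mN.
apply: measurable_funM.
  apply: measurable_fun_ifT => //; apply: measurable_fun_ltr => //.
  by apply: measurable_funM; exact: mN.
apply: measurable_funM; first exact: mN.
by apply: mV; apply: measurable_funX; apply: measurable_funD; exact: mN.
Qed.

Let min_div_le (t : R) j : 0 < t ->
  Num.min 1 t / (t * (t ^+ j.+1 + 1)) <= 2 / (1 + t ^+ 2).
Proof.
move=> t0; have tk : 0 <= t ^+ j.+1 by rewrite exprn_ge0// ltW.
rewrite ler_pdivrMr; last by rewrite mulr_gt0// ltr_wpDl.
rewrite mulrAC ler_pdivlMr; last by rewrite ltr_pwDl// sqr_ge0.
have [t1|t1] := leP 1 t.
  have h : t <= t ^+ j.+1 by rewrite -[leLHS]expr1 ler_weXn2l.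
  nra.
have h : t ^+ 2 <= 1 by rewrite exprn_ile1// ltW.
nra.
Qed.

(** Scaling identity with a = |c|, y = |x|, p = a^j, q = y^j: apart from one factor a, everything is
    a function of t = a y and m. *)
Let near_aux (a y m p q : R) : 0 < a -> 0 < y -> 0 < p -> 0 < q ->
  m * q * ((a * p)^-1 / (y * q * (y * q + (a * p)^-1))) =
  a * (m / (a * y * (a * y * (p * q) + 1))).
Proof.
move=> a0 y0 p0 q0.
have h1 : 0 < y * q * (a * p) + 1 by rewrite addr_gt0// !mulr_gt0.
have h2 : 0 < a * y * (p * q) + 1 by rewrite addr_gt0// !mulr_gt0.
by field; rewrite !gt_eqF.
Qed.

Let far_aux (a y p u v s n : R) : 0 < a -> 0 < y -> 0 < p -> 0 < s ->
  p^-1 * (n * u + v / s) * (a * p / s) = a * (n * (u / s) + v / s ^+ 2).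
Proof.
move=> a0 y0 p0 s0; by field; rewrite !gt_eqF.
Qed.

(** The factor next to [wnear] is the value from [integral_radial_near] at r^(i+1) = |c|^-(j+1),
    without 2 / (i+1). In t = |c x| the claim reduces to [min_div_le]. *)
Lemma wnear_le (j : nat) (c x : R) : c != 0 -> x != 0 ->
  wnear j c x * ((`|c| ^+ j.+1)^-1 / (`|x| ^+ j.+1 * (`|x| ^+ j.+1 + (`|c| ^+ j.+1)^-1)))
  <= 2 * (`|c| / (1 + (c * x) ^+ 2)).
Proof.
rewrite -normr_gt0 => a0; rewrite -normr_gt0 => x0.
rewrite /wnear -(real_normK (num_real (c * x))) !normrM.
move: `|c| `|x| a0 x0 => a y a0 y0.
rewrite (exprS a j) (exprS y j) near_aux ?exprn_gt0// -exprMn [leRHS]mulrCA ler_wpM2l ?(ltW a0)//.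
by rewrite -exprS; apply: min_div_le; rewrite mulr_gt0.
Qed.

(** The counterpart for [integral_radial_far]. Each 4 is the constant 2 / V^q + 2 of
    [le_pow_oneDsqrV] at V = 1, used with q = 1 for the term weighted by j and with q = 2 for the
    other. *)
Lemma wfar_le (j : nat) (c x : R) : c != 0 ->
  wfar j c x / (`|x| ^+ j.+1 + (`|c| ^+ j.+1)^-1)
  <= (4 * j%:R + 4) * (`|c| / (1 + (c * x) ^+ 2)).
Proof.
rewrite -normr_gt0 => a0; rewrite /wfar -(real_normK (num_real (c * x))) !normrM.
have y0 := normr_ge0 x.
move: `|c| `|x| a0 y0 => a y a0 y0.
have t0 : 0 <= a * y by rewrite mulr_ge0// ltW.
have E : y ^+ j.+1 + (a ^+ j.+1)^-1 = ((a * y) ^+ j.+1 + 1) / a ^+ j.+1.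
  have ak : a ^+ j.+1 != 0 by rewrite expf_neq0// gt_eqF.
  by rewrite exprMn mulrDl mul1r mulrAC mulfV ?mul1r.
rewrite E invf_div; move: (a * y) t0 => t t0.
have s0 : 0 < t ^+ j.+1 + 1 by rewrite ltr_wpDl// exprn_ge0.
rewrite (exprS a) (far_aux _ _ _ a0 ltr01)// ?exprn_gt0//.
rewrite [leRHS]mulrCA ler_wpM2l ?(ltW a0)// mulrDl; apply: lerD.
  (* For j = 0 the truncated [j.-1] would violate the exponent condition of [le_pow_oneDsqrV], but
     the term itself is zero. *)
  have [->|jp] := posnP j; first by rewrite !(mul0r, mulr0).
  rewrite -mulrA mulrCA ler_wpM2l//.
  have := @le_pow_oneDsqrV _ j.+1 j.-1 1 1 t isT _ ltr01 t0.
  rewrite expr1n divr1 expr1 => h; apply: le_trans (h _) _; first lia.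
  by rewrite ler_wpM2r ?invr_ge0 ?addr_ge0 ?sqr_ge0//; lra.
have := @le_pow_oneDsqrV _ j.+1 (2 * j) 2 1 t isT _ ltr01 t0.
rewrite expr1n divr1 => h; apply: le_trans (h _) _; first lia.
by rewrite ler_wpM2r ?invr_ge0 ?addr_ge0 ?sqr_ge0//; lra.
Qed.

Lemma integral_wker_eta j i (c x : R) :
  (\int[mu]_eta (wker j i c eta x)%:E <=
   (2 / i.+1%:R * (4 * j%:R + 6) * (`|c| / (1 + (c * x) ^+ 2)))%:E)%E.
Proof.
have [->|c0] := eqVneq c 0.
  under eq_integral => e _.
    rewrite /wker normr0 [X in _ * X < _]exprS mul0r mulr0 ltr01 /wnear mul0r normr0.
    rewrite min_r// !mul0r.
    over.
  by rewrite integral0 normr0 !(mul0r, mulr0).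
have a0 : 0 < `|c| by rewrite normr_gt0.
have ck : 0 < `|c| ^+ j.+1 by rewrite exprn_gt0.
(* The value of |eta| at which the two regimes of [wker] meet. *)
pose r : R := ((`|c| ^+ j.+1)^-1) `^ (i.+1%:R^-1).
have r0 : 0 < r by rewrite powR_gt0// invr_gt0.
have rl : r ^+ i.+1 = (`|c| ^+ j.+1)^-1.
  by rewrite -powR_mulrn ?ltW// -powRrM mulVf ?pnatr_eq0// powRr1// invr_ge0 ltW.
pose A := `|x| ^+ j.+1; have A0 : 0 <= A by rewrite exprn_ge0.
pose h (e : R) := `|e| ^+ i / (A + `|e| ^+ i.+1) ^+ 2.
have h0 e : 0 <= h e by apply: divr_ge0; [exact: exprn_ge0|exact: sqr_ge0].
have cond (e : R) : (`|e| ^+ i.+1 * `|c| ^+ j.+1 < 1) = (`|e| < r).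
  by rewrite -ltr_pdivlMr// div1r -rl ltr_pXn2r// ?nnegrE ?normr_ge0// ltW.
have mh : measurable_fun setT h.
  have mX n : measurable_fun setT (fun x : R => `|x| ^+ n) by apply: measurable_funX; exact: normr_measurable.
  apply: measurable_funM => //; apply: (measurableT_comp measurable_invr).
  by apply: measurable_funX; exact: measurable_funD.
have mc : measurable_fun setT (fun e : R => `|e| < r).
  by apply: measurable_fun_ltr => //; exact: normr_measurable.
under eq_integral => e _.
  rewrite (_ : wker j i c e x = wnear j c x * (if `|e| < r then h e else 0)
    + wfar j c x * (if `|e| < r then 0 else h e)); last first.
    by rewrite /wker cond; case: ifP => _; rewrite mulr0 ?addr0 ?add0r.
  rewrite EFinD !EFinM.
  over.
have i0 e : 0 <= (if `|e| < r then h e else 0) by case: ifP.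
have i1 e : 0 <= (if `|e| < r then 0 else h e) by case: ifP.
have m0 : measurable_fun setT (fun e : R => (if `|e| < r then h e else 0)%:E).
  by apply/measurable_EFinP; exact: measurable_fun_ifT.
have m1 : measurable_fun setT (fun e : R => (if `|e| < r then 0 else h e)%:E).
  by apply/measurable_EFinP; exact: measurable_fun_ifT.
rewrite ge0_integralD//; last 4 first.
- by move=> e _; rewrite mule_ge0// lee_fin ?wnear_ge0.
- by apply: measurable_funeM.
- by move=> e _; rewrite mule_ge0// lee_fin ?wfar_ge0.
- by apply: measurable_funeM.
rewrite !ge0_integralZl_EFin ?wnear_ge0 ?wfar_ge0//; last 2 first.
- by move=> e _; rewrite lee_fin.
- by move=> e _; rewrite lee_fin.
(* Here 4 j + 6 splits as 2 from [wnear_le] plus 4 j + 4 from [wfar_le]. *)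
rewrite (_ : 2 / _ * _ * _ = 2 / i.+1%:R * (2 * (`|c| / (1 + (c * x) ^+ 2))) +
  2 / i.+1%:R * ((4 * j%:R + 4) * (`|c| / (1 + (c * x) ^+ 2)))); last by ring.
have l0 : 0 <= 2 / i.+1%:R :> R by rewrite divr_ge0.
rewrite EFinD; apply: leeD.
  (* At x = 0 the near integral in eta may diverge, but its coefficient [wnear] is zero and 0 times
     infinity is 0. *)
  have [x0|x0] := eqVneq x 0.
    rewrite {1}x0 /wnear mulr0 normr0 min_r// mul0r mul0e lee_fin.
    by rewrite !mulr_ge0// invr_ge0 addr_ge0// sqr_ge0.
  have Ap : 0 < A by rewrite exprn_gt0// normr_gt0.
  apply: le_trans (lee_wpmul2l _ (integral_radial_near i Ap r0)) _.
    by rewrite lee_fin wnear_ge0.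
  by rewrite -EFinM lee_fin mulrCA ler_wpM2l// rl; exact: wnear_le.
apply: le_trans (lee_wpmul2l _ (integral_radial_far i A0 r0)) _.
  by rewrite lee_fin wfar_ge0.
by rewrite -EFinM lee_fin rl mulrCA ler_wpM2l//; exact: wfar_le.
Qed.

(** Tonelli puts the eta integral inside, where [integral_wker_eta] evaluates it; the remaining
    function of xi integrates to a bound free of c. *)
Lemma integral_wker j i (c : R) :
  (\int[mu]_eta \int[mu]_xi (wker j i c eta xi)%:E <=
   (2 / i.+1%:R * (4 * j%:R + 6) * pi)%:E)%E.
Proof.
have C0 : 0 <= 2 / i.+1%:R * (4 * j%:R + 6) :> R.
  by rewrite mulr_ge0 ?divr_ge0 ?addr_ge0// mulr_ge0.
have mw : measurable_fun setT (fun p : R * R => wker j i c p.1 p.2).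
  exact: (measurable_wker j i (measurable_cst c) measurable_fst measurable_snd).
have := @fubini_tonelli _ _ _ _ R mu mu (fun p : R * R => (wker j i c p.1 p.2)%:E).
move=> ->; last 2 first.
- exact/measurable_EFinP.
- by move=> p; rewrite lee_fin wker_ge0.
apply: le_trans (_ : _ <= \int[mu]_x (2 / i.+1%:R * (4 * j%:R + 6) * (`|c| / (1 + (c * x) ^+ 2)))%:E)%E _.
  apply: ge0_le_integral => //.
  - by move=> x _; apply: integral_ge0 => e _; rewrite lee_fin wker_ge0.
  - have mG : measurable_fun setT (fubini_G mu (fun p : R * R => (wker j i c p.1 p.2)%:E)).
      apply: measurable_fun_fubini_tonelli_G; first exact/measurable_EFinP.
      by move=> p; rewrite lee_fin wker_ge0.
    exact: mG.
  - apply/measurable_EFinP; apply: measurable_funM => //; apply: measurable_funM => //.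
    apply: (measurableT_comp measurable_invr); apply: measurable_funD => //.
    by apply: measurable_funX; exact: measurable_funM.
  - by move=> x _; exact: integral_wker_eta.
under eq_integral => x _ do rewrite EFinM.
rewrite ge0_integralZl_EFin//.
- by rewrite [leRHS]EFinM lee_wpmul2l ?lee_fin//; exact: integral_scaled_oneDsqrV.
- by move=> x _; rewrite lee_fin divr_ge0// addr_ge0// sqr_ge0.
- apply/measurable_EFinP; apply: measurable_funM => //.
  apply: (measurableT_comp measurable_invr); apply: measurable_funD => //.
  by apply: measurable_funX; exact: measurable_funM.
Qed.

End Majorant.

(** * From the transform of the kernel to the majorant *)

Section KernelMajorant.
Context {R : realType}.
Notation mu := (@lebesgue_measure R).

(** With z = s - a v, the imaginary part gives |v| <= |z| / |Im a|, and then |s| <= |z| + |a| |v|.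
    Adding the two gives the reciprocal of the chosen [dl]. *)
Lemma cabs_sub_ge (a : R[i]) : cim a != 0 ->
  exists2 dl : R, 0 < dl & forall s v : R, dl * (`|s| + `|v|) <= cabs (s%:C - a * v%:C).
Proof.
move=> a0; have b0 : 0 < `|cim a| by rewrite normr_gt0.
have M0 := cabs_ge0 a.
have K0 : 0 < 1 + (cabs a + 1) / `|cim a|.
  by rewrite ltr_pwDl// divr_ge0// addr_ge0.
exists (1 + (cabs a + 1) / `|cim a|)^-1; first by rewrite invr_gt0.
move=> s v; rewrite ler_pdivrMl//.
set z := s%:C - a * v%:C.
have h1 : `|v| <= cabs z / `|cim a|.
  rewrite ler_pdivlMr//; apply: le_trans (cabs_ge_im z).
  by rewrite /z cimD cimN cimM /cre/cim/= mulr0 !add0r normrN normrM mulrC.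
have h2 : `|s| <= cabs z + cabs a * `|v|.
  have -> : `|s| = cabs (z + a * v%:C) by rewrite /z subrK cabsR.
  by apply: le_trans (cabsD _ _) _; rewrite cabsM cabsR.
have h3 := ler_wpM2l M0 h1.
rewrite (_ : _ * cabs z = cabs z + cabs a * (cabs z / `|cim a|) + cabs z / `|cim a|); last by ring.
lra.
Qed.

(** The constant adds the one of [ker_hat_le_near] to the one of [ker_hat_le_far], so that a single
    multiple of [wker] serves in both regimes. *)
Lemma ker_hat_majorant (j i : nat) (a b : R[i]) (dl : R) : 0 < dl -> ~~ odd j ->
  0 < cim a * cim b -> a != b ->
  (forall s v : R, dl * (`|s| + `|v|) <= cabs (s%:C - a * v%:C)) ->
  (forall s v : R, dl * (`|s| + `|v|) <= cabs (s%:C - b * v%:C)) ->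
  forall eta c : R, eta != 0 ->
  ((cabs ((`|eta| ^+ i)%:C * ker_hat j (a * (eta ^+ i.+1)%:C) (b * (eta ^+ i.+1)%:C) c))%:E <=
   \int[mu]_xi ((2 * dl ^- 2 + 2 * j.+1%:R * dl ^- 3) * wker j i c eta xi)%:E)%E.
Proof.
move=> dl0 jeven ab0 ab Ha Hb eta c eta0.
have v0 : eta ^+ i.+1 != 0 by rewrite expf_neq0.
set V := `|eta| ^+ i.+1.
have V0 : 0 < V by rewrite exprn_gt0// normr_gt0.
have VE : V = `|eta ^+ i.+1| by rewrite normrX.
have AB0 : 0 < cim (a * (eta ^+ i.+1)%:C) * cim (b * (eta ^+ i.+1)%:C).
  rewrite ![_ * (eta ^+ _)%:C]mulrC !cimCM mulrACA -expr2 mulr_gt0//.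
  by rewrite lt_neqAle sqr_ge0 andbT eq_sym expf_neq0.
have AB : a * (eta ^+ i.+1)%:C != b * (eta ^+ i.+1)%:C.
  rewrite -subr_eq0 -mulrBl mulf_neq0 ?subr_eq0//.
  by apply: contra_neq v0 => /(congr1 (@cre R)).
have HA x : dl * (`|x| ^+ j.+1 + V) <= cabs ((x ^+ j.+1)%:C - a * (eta ^+ i.+1)%:C).
  by rewrite VE -normrX; exact: Ha.
have HB x : dl * (`|x| ^+ j.+1 + V) <= cabs ((x ^+ j.+1)%:C - b * (eta ^+ i.+1)%:C).
  by rewrite VE -normrX; exact: Hb.
have e0 : 0 <= `|eta| ^+ i by rewrite exprn_ge0.
have mX n : measurable_fun setT (fun x : R => `|x| ^+ n) by apply: measurable_funX; exact: normr_measurable.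
have mD n : measurable_fun setT (fun x : R => (`|x| ^+ j.+1 + V) ^- n).
  by apply: (measurableT_comp measurable_invr); apply: measurable_funX; exact: measurable_funD.
have D0 (x : R) : 0 < `|x| ^+ j.+1 + V by rewrite ltr_wpDl// exprn_ge0.
have dV n : 0 <= dl ^- n by rewrite invr_ge0 exprn_ge0// ltW.
have mw : measurable_fun setT (fun xi : R => ((2 * dl ^- 2 + 2 * j.+1%:R * dl ^- 3) * wker j i c eta xi)%:E).
  apply/measurable_EFinP; apply: measurable_funM => //.
  exact: (@measurable_wker _ _ _ j i (fun _ : R => c) (fun _ : R => eta) (fun x : R => x)).
rewrite cabsM cabsR ger0_norm// EFinM.
have [near|far] := boolP (`|eta| ^+ i.+1 * `|c| ^+ j.+1 < 1).
  apply: le_trans (lee_wpmul2l _ (ker_hat_le_near V0 dl0 AB0 AB jeven HA HB c)) _.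
    by rewrite lee_fin.
  have m1 : measurable_fun setT ((fun _ : R => (1 : R)) \min (fun x : R => `|c * x|)).
    apply: measurable_minr => //.
    by apply: measurableT_comp => //; exact: measurable_funM.
  have m2 : measurable_fun setT (fun x : R => (2 * dl ^- 2 *
      (Num.min 1 `|c * x| * `|x| ^+ j / (`|x| ^+ j.+1 + V) ^+ 2))%:E).
    apply/measurable_EFinP.
    exact: (measurable_funM (measurable_cst _) (measurable_funM (measurable_funM m1 (mX j)) (mD 2))).
  have p0 x : 0 <= Num.min 1 `|c * x| * `|x| ^+ j / (`|x| ^+ j.+1 + V) ^+ 2.
    by apply: divr_ge0; [exact: (wnear_ge0 j c x)|exact: sqr_ge0].
  rewrite -ge0_integralZl_EFin//; last first.
    by move=> x _; rewrite lee_fin mulr_ge0// mulr_ge0.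
  apply: ge0_le_integral => //.
  - by move=> x _; rewrite mule_ge0// lee_fin// mulr_ge0// mulr_ge0.
  - exact: measurable_funeM.
  - move=> x _; rewrite -EFinM lee_fin /wker near /wnear -/V.
    rewrite (_ : _ * (2 * _ * _) = 2 * dl ^- 2 * (Num.min 1 `|c * x| * `|x| ^+ j *
      (`|eta| ^+ i / (`|x| ^+ j.+1 + V) ^+ 2))); last by ring.
    rewrite ler_wpM2r ?lerDl//.
      apply: mulr_ge0; first exact: (wnear_ge0 j c x).
      by apply: divr_ge0 => //; exact: sqr_ge0.
    by rewrite !mulr_ge0.
have c0 : c != 0.
  by apply: contraNneq far => ->; rewrite normr0 expr0n/= mulr0 ltr01.
rewrite -leNgt -/V in far.
have a0 : 0 < `|c| by rewrite normr_gt0.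
have Hfar : ((cabs (ker_hat j (a * (eta ^+ i.+1)%:C) (b * (eta ^+ i.+1)%:C) c))%:E <=
    \int[mu]_x (`|c|^-1 * (dl ^- 2 * (j%:R * (`|x| ^+ j.-1 / (`|x| ^+ j.+1 + V) ^+ 2)) +
    2 * j.+1%:R * dl ^- 3 * (`|x| ^+ (2 * j) / (`|x| ^+ j.+1 + V) ^+ 3)))%:E)%E.
  exact: ker_hat_le_far.
apply: (@le_trans _ _ ((`|eta| ^+ i)%:E * (\int[mu]_x (`|c|^-1 * (dl ^- 2 * (j%:R * (`|x| ^+ j.-1 / (`|x| ^+ j.+1 + V) ^+ 2)) +
    2 * j.+1%:R * dl ^- 3 * (`|x| ^+ (2 * j) / (`|x| ^+ j.+1 + V) ^+ 3)))%:E))%E).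
  by apply: lee_wpmul2l => //; rewrite lee_fin.
have m2 : measurable_fun setT (fun x : R => (`|c|^-1 * (dl ^- 2 * (j%:R * (`|x| ^+ j.-1 / (`|x| ^+ j.+1 + V) ^+ 2)) +
  2 * j.+1%:R * dl ^- 3 * (`|x| ^+ (2 * j) / (`|x| ^+ j.+1 + V) ^+ 3)))%:E).
  apply/measurable_EFinP.
  exact: (measurable_funM (measurable_cst _) (measurable_funD
    (measurable_funM (measurable_cst _) (measurable_funM (measurable_cst _)
      (measurable_funM (mX _) (mD 2))))
    (measurable_funM (measurable_cst _) (measurable_funM (mX _) (mD 3))))).
have q0 n m (x : R) : 0 <= `|x| ^+ n / (`|x| ^+ j.+1 + V) ^+ m.
  by apply: divr_ge0; apply: exprn_ge0 => //; exact: ltW.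
have g0 (x : R) : 0 <= `|c|^-1 * (dl ^- 2 * (j%:R * (`|x| ^+ j.-1 / (`|x| ^+ j.+1 + V) ^+ 2)) +
  2 * j.+1%:R * dl ^- 3 * (`|x| ^+ (2 * j) / (`|x| ^+ j.+1 + V) ^+ 3)).
  have Q0 : 0 <= 2 * j.+1%:R * dl ^- 3 by apply: mulr_ge0 => //; apply: mulr_ge0.
  apply: mulr_ge0; first by rewrite invr_ge0.
  apply: addr_ge0; apply: mulr_ge0 => //.
  by apply: mulr_ge0.
rewrite -ge0_integralZl_EFin//; last by move=> x _; rewrite lee_fin.
apply: ge0_le_integral => //.
- by move=> x _; rewrite mule_ge0// lee_fin.
- exact: measurable_funeM.
move=> x _; rewrite -EFinM lee_fin /wker -/V ltNge far /= /wfar.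
pose D := `|x| ^+ j.+1 + V.
have t1 : `|c|^-1 * (j%:R * `|x| ^+ j.-1) = (`|c| ^+ j)^-1 * (j%:R * `|c * x| ^+ j.-1).
  have [->|jp] := posnP j; first by rewrite !mul0r !mulr0.
  have jE : `|c| ^+ j = `|c| * `|c| ^+ j.-1 by rewrite -exprS prednK.
  rewrite normrM exprMn jE.
  by field; rewrite expf_neq0 ?gt_eqF.
(* The far condition 1 <= V |c|^(j+1) gives |c x|^(j+1) + 1 <= |c|^(j+1) D, which removes eta from
   this factor. *)
have t2 : `|c|^-1 * (`|x| ^+ (2 * j) / D) <=
    (`|c| ^+ j)^-1 * (`|c * x| ^+ (2 * j) / (`|c * x| ^+ j.+1 + 1)).
  have p1 : 0 < `|c * x| ^+ j.+1 + 1 by rewrite ltr_wpDl// exprn_ge0.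
  have p2 : (`|c * x| ^+ j.+1 + 1) <= `|c| ^+ j.+1 * D.
    by rewrite /D mulrDr normrM exprMn lerD2l mulrC.
  rewrite (_ : _ * _ = (`|c| ^+ j)^-1 * (`|c * x| ^+ (2 * j) / (`|c| ^+ j.+1 * D))); last first.
    rewrite normrM exprMn mul2n -addnn !exprD exprS; field.
    by rewrite expf_neq0 ?gt_eqF//= D0.
  rewrite ler_wpM2l ?invr_ge0 ?exprn_ge0// ler_wpM2l ?exprn_ge0//.
  by rewrite lef_pV2 ?posrE// mulr_gt0 ?exprn_gt0// D0.
pose w := `|eta| ^+ i / D ^+ 2.
have w0 : 0 <= w by apply: divr_ge0 => //; exact: sqr_ge0.
rewrite (_ : _ * (_^-1 * _) = dl ^- 2 * (`|c|^-1 * (j%:R * `|x| ^+ j.-1)) * w +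
   2 * j.+1%:R * dl ^- 3 * (`|c|^-1 * (`|x| ^+ (2 * j) / D)) * w); last first.
  by rewrite /w /D; field; rewrite !gt_eqF// D0.
rewrite t1 -/D -/w -mulrDl [leRHS]mulrA ler_wpM2r// mulrDr.
set u1 := (`|c| ^+ j)^-1 * (j%:R * _); set u2 := (`|c| ^+ j)^-1 * (_ / _) in t2 *.
have u10 : 0 <= u1 by rewrite !mulr_ge0 ?invr_ge0 ?exprn_ge0.
have u20 : 0 <= u2 by rewrite !mulr_ge0 ?invr_ge0 ?exprn_ge0// addr_ge0// exprn_ge0.
have Q0 : 0 <= 2 * j.+1%:R * dl ^- 3 by rewrite !mulr_ge0.
have h1 := ler_wpM2l Q0 t2; have h2 := mulr_ge0 Q0 u10.
have h3 := mulr_ge0 (dV 2) u10; have h4 := mulr_ge0 (dV 2) u20.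
rewrite [leRHS](_ : _ = dl ^- 2 * u1 + (dl ^- 2 * u1 + dl ^- 2 * u2 + dl ^- 2 * u2 +
  2 * j.+1%:R * dl ^- 3 * u1) + 2 * j.+1%:R * dl ^- 3 * u2); last by ring.
lra.
Qed.

End KernelMajorant.

(** * Continuous functions on the plane are measurable *)

Section PlaneMeasurability.
Context {R : realType}.

(** Links the product topology to the product sigma-algebra: an open set is the countable union of
    the rational open boxes that it contains. *)
Lemma open_prod_measurable (A : set (R * R)) : open A -> measurable A.
Proof.
move=> oA.
pose box (q : (rat * rat) * (rat * rat)) : set (R * R) :=
  `]ratr q.1.1, ratr q.1.2[%classic `*` `]ratr q.2.1, ratr q.2.2[%classic.
pose D := [set q | box q `<=` A].
have -> : A = \bigcup_(q in D) box q.
  apply/seteqP; split => [p Ap|p [q Dq]]; last exact: Dq.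
  have : nbhs p A by exact: open_nbhs_nbhs.
  move=> [[U V] /= [nU nV] UV].
  have rat_itv (x : R) (W : set R) : nbhs x W ->
      exists2 q : rat * rat, x \in `]ratr q.1, ratr q.2[ &
        (`]ratr q.1, ratr q.2[%classic `<=` W).
    move=> /nbhs_ballP[e /= e0 eW].
    have [q1] : exists q : rat, ratr q \in `]x - e, x[ by apply: rat_in_itvoo; rewrite ltrBlDr ltrDl.
    rewrite in_itv/= => /andP[h1 h2].
    have [q2] : exists q : rat, ratr q \in `]x, x + e[ by apply: rat_in_itvoo; rewrite ltrDl.
    rewrite in_itv/= => /andP[h3 h4].
    exists (q1, q2); first by rewrite in_itv/= h2 h3.
    move=> y /=; rewrite in_itv/= => /andP[y1 y2]; apply: eW.
    by rewrite /ball/= ltr_norml; apply/andP; split; lra.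
  have [q1 m1 s1] := rat_itv _ _ nU; have [q2 m2 s2] := rat_itv _ _ nV.
  exists (q1, q2).
    by move=> y /= [y1 y2]; apply: UV; split; [exact: s1|exact: s2].
  by split.
rewrite bigcup_mkcond; apply: countable_bigcupT_measurable; first exact: countableP.
move=> q; case: ifP => // _.
by apply: measurableX; exact: measurable_itv.
Qed.

Lemma continuous_prod_measurable (f : R * R -> R) : continuous f -> measurable_fun setT f.
Proof.
move=> /continuousP cf; apply: (measurability _ (RGenOpens.measurableE R)) => //.
move=> _ [_ [a [b ->] <-]]; rewrite setTI; apply: open_prod_measurable.
exact/cf/interval_open.
Qed.

Lemma ccontinuous_prod_measurable (F : R * R -> R[i]) : ccontinuous F -> cmeasurable F.
Proof. by move=> [? ?]; split; exact: continuous_prod_measurable. Qed.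

End PlaneMeasurability.

(** * Stability, decay and integrability of test functions *)

Section TestFunctions.
Context {R : realType}.
Implicit Types f g : R * R -> R[i].
Notation mu := (@lebesgue_measure R).

(** The last letter of a word acts first, so the conditions for a derivative of f are those for f
    along longer words. *)
Lemma pdw_rcons w b f : pdw (rcons w b) f = pdw w (if b then pd1 f else pd2 f).
Proof. by rewrite /pdw foldr_rcons. Qed.

Lemma derive1_near0 (u : R -> R) (x : R) : (\forall t \near x, u t = 0) -> derive1 u x = 0.
Proof.
move=> u0; rewrite derive1E (@near_eq_derive _ _ _ _ (cst 0)) ?derive_cst//.
Qed.

Lemma test_fun_pd1 f : test_fun f -> test_fun (pd1 f).
Proof.
move=> [sf [M Mf]]; split.
  by move=> w; have := sf (rcons w true); rewrite pdw_rcons.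
exists M => -[x y] /= h; rewrite /pd1 /=.
(* If |x| > M, this persists near x; if |y| > M, then f vanishes on the whole horizontal line. *)
have u0 : \forall t \near x, f (t, y) = 0.
  case: h => h; last by apply: filterE => t; apply: Mf; right.
  have /cvgr_gt/(_ _ h) := @norm_continuous _ R^o x.
  by apply: filterS => t ht; apply: Mf; left.
rewrite !derive1_near0//; first by apply: filterS u0 => t ->.
by apply: filterS u0 => t ->.
Qed.

Lemma test_fun_pd2 f : test_fun f -> test_fun (pd2 f).
Proof.
move=> [sf [M Mf]]; split.
  by move=> w; have := sf (rcons w false); rewrite pdw_rcons.
exists M => -[x y] /= h; rewrite /pd2 /=.
have u0 : \forall t \near y, f (x, t) = 0.
  case: h => h; first by apply: filterE => t; apply: Mf; left.
  have /cvgr_gt/(_ _ h) := @norm_continuous _ R^o y.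
  by apply: filterS => t ht; apply: Mf; right.
rewrite !derive1_near0//; first by apply: filterS u0 => t ->.
by apply: filterS u0 => t ->.
Qed.

Lemma test_fun_iter_pd1 n f : test_fun f -> test_fun (iter n (@pd1 R) f).
Proof. by move=> tf; elim: n => //= n; exact: test_fun_pd1. Qed.

Lemma test_fun_iter_pd2 n f : test_fun f -> test_fun (iter n (@pd2 R) f).
Proof. by move=> tf; elim: n => //= n; exact: test_fun_pd2. Qed.

Lemma test_fun_ccontinuous f : test_fun f -> ccontinuous f.
Proof. by move=> [/(_ [::]) /= [c1 [c2 _]] _]. Qed.

Lemma is_cderive_pd1 f (x y : R) : test_fun f ->
  is_cderive (fun t => f (t, y)) x (pd1 f (x, y)).
Proof.
move=> [/(_ [::]) /= [_ [_ /(_ (x, y)) [d1 [d2 _]]]] _]; split; rewrite /pd1 /=.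
  by rewrite {2}/cre/= derive1E; exact/derivableP.
by rewrite {2}/cim/= derive1E; exact/derivableP.
Qed.

Lemma is_cderive_pd2 f (x y : R) : test_fun f ->
  is_cderive (fun t => f (x, t)) y (pd2 f (x, y)).
Proof.
move=> [/(_ [::]) /= [_ [_ /(_ (x, y)) [_ [_ [d1 d2]]]]] _]; split; rewrite /pd2 /=.
  by rewrite {2}/cre/= derive1E; exact/derivableP.
by rewrite {2}/cim/= derive1E; exact/derivableP.
Qed.

Lemma test_fun_dominated f : test_fun f -> exists2 C : R, 0 <= C &
  forall x y, cabs (f (x, y)) <= C * ((1 + x ^+ 2)^-1 * (1 + y ^+ 2)^-1).
Proof.
move=> tf; have [c1 c2] := test_fun_ccontinuous tf; have [_ [M0 Mf]] := tf.
pose M := `|M0|.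
have {}Mf p : (M < `|p.1| \/ M < `|p.2|) -> f p = 0.
  by move=> h; apply: Mf; case: h => h; [left|right]; apply: le_lt_trans (ler_norm _) h.
pose K : set (R * R) := `[- M, M]%classic `*` `[- M, M]%classic.
have cK : compact K by apply: compact_setX; exact: segment_compact.
have bnd (u : R * R -> R) : continuous u -> exists2 B : R, 0 <= B & forall p, K p -> `|u p| <= B.
  move=> cu.
  have : compact (u @` K).
    by apply: continuous_compact => //; exact: continuous_subspaceT.
  move=> /compact_bounded [B [_ hB]]; exists (`|B| + 1); first by rewrite addr_ge0.
  move=> p Kp; apply: (hB (`|B| + 1)); last by exists p.
  by apply: le_lt_trans (ler_norm _) _; rewrite ltrDl.
have [B1 B10 h1] := bnd _ c1; have [B2 B20 h2] := bnd _ c2.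
(* B1 + B2 bounds |f| on the square K; each factor 1 + M^2 makes up for the decay of one variable
   there. *)
exists ((B1 + B2) * ((1 + M ^+ 2) * (1 + M ^+ 2))).
  by rewrite !mulr_ge0// ?addr_ge0// sqr_ge0.
move=> x y.
have q0 (z : R) : 0 < 1 + z ^+ 2 by rewrite ltr_pwDl// sqr_ge0.
have [xM|xM] := ltP M `|x|.
  rewrite Mf; last by left.
  by rewrite cabs0 !mulr_ge0 ?addr_ge0 ?sqr_ge0// invr_ge0 ltW.
have [yM|yM] := ltP M `|y|.
  rewrite Mf; last by right.
  by rewrite cabs0 !mulr_ge0 ?addr_ge0 ?sqr_ge0// invr_ge0 ltW.
have Kp : K (x, y) by split; rewrite /= in_itv/= -ler_norml.
have mon (z : R) : `|z| <= M -> 1 <= (1 + M ^+ 2) / (1 + z ^+ 2).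
  move=> zM; rewrite ler_pdivlMr// mul1r lerD2l -(real_normK (num_real z)).
  by rewrite lerXn2r ?nnegrE ?normr_ge0// normr_ge0.
apply: (@le_trans _ _ (B1 + B2)).
  by apply: le_trans (cabs_le_reim _) _; apply: lerD; [exact: h1|exact: h2].
rewrite -mulrA mulrACA ler_peMr ?addr_ge0//.
by apply: mulr_ege1; exact: mon.
Qed.

Lemma test_fun_integrable f : test_fun f -> cintegrable (mu \x mu)%E f.
Proof.
move=> tf; have [C C0 h] := test_fun_dominated tf.
apply: (@cintegrable_prod _ _ _ _ _ mu mu f (fun x => C / (1 + x ^+ 2)) (fun y => (1 + y ^+ 2)^-1)).
- by apply: ccontinuous_prod_measurable; exact: test_fun_ccontinuous.
- rewrite /comp; under eq_fun do rewrite EFinM.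
  by apply: integrableZl => //; exact: integrable_oneDsqrV.
- exact: integrable_oneDsqrV.
- by move=> x y; apply: le_trans (h x y) _; rewrite mulrA.
Qed.

End TestFunctions.

Lemma cintegrable_mul_expi {R : realType} {d : measure_display} {T : measurableType d}
    (m : {measure set T -> \bar R}) (F : T -> R[i]) (u : T -> R) :
  cintegrable m F -> measurable_fun setT u -> cintegrable m (fun x => F x * expi (u x)).
Proof.
move=> iF mu; apply: (@le_cintegrable _ _ _ m _ (fun x => cabs (F x))).
- apply: cmeasurableM; first exact: cintegrable_measurable iF.
  exact: cmeasurable_expi.
- by move=> x; rewrite cabsM cabs_expi mulr1.
- exact: cintegrable_cabs.
Qed.

Lemma cintegral0 {R : realType} {d : measure_display} {T : measurableType d}
    (m : {measure set T -> \bar R}) : cintegral m (fun=> 0) = 0.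
Proof.
by rewrite /cintegral /Rintegral /cre /cim /= !integral0.
Qed.

(* The library's sigma-finite instance of a product measure is shadowed by the
   one for subprobabilities, so the plane gets a named copy of its measure. *)
Section PlaneMeasure.
Context {R : realType}.
Notation mu := (@lebesgue_measure R).

Definition plane_measure := (mu \x mu)%E.

HB.instance Definition _ := Measure.on plane_measure.

Lemma plane_measure_sigma_finite : sigma_finite setT plane_measure.
Proof.
exists (fun n : nat => `[- n%:R, n%:R]%classic `*` `[- n%:R, n%:R]%classic).
  apply/esym/seteqP; split => // -[x y] _.
  have [n hn] : exists n : nat, Num.max `|x| `|y| <= n%:R.
    by exists (Num.truncn (Num.max `|x| `|y|)).+1; apply: ltW; apply: truncnS_gt.
  move: hn; rewrite ge_max => /andP[xn yn].
  by exists n => //; split; rewrite /= in_itv/= -ler_norml.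
move=> n; split; first by apply: measurableX; exact: measurable_itv.
rewrite /plane_measure product_measure1E; [|exact: measurable_itv|exact: measurable_itv].
by rewrite /= lebesgue_measure_itv/=; case: ifP => _; rewrite ?mule0// -!EFinB -EFinM ltry.
Qed.

HB.instance Definition _ :=
  Measure_isSigmaFinite.Build _ _ _ plane_measure plane_measure_sigma_finite.

End PlaneMeasure.

(** * Fourier transforms of test functions *)

Section FourierTransform.
Context {R : realType}.
Implicit Types (f g : R * R -> R[i]) (p q : R * R).
Notation mu := (@lebesgue_measure R).

Definition phase (q p : R * R) : R := - (2 * pi) * (p.1 * q.1 + p.2 * q.2).

Lemma fourier2E f q :
  fourier2 f q = cintegral (mu \x mu)%E (fun p => f p * expi (phase q p)).
Proof. by []. Qed.

Lemma measurable_phase q : measurable_fun setT (phase q).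
Proof.
apply: measurable_funM => //.
by apply: measurable_funD; apply: measurable_funM => //; first
  [exact: measurable_fst|exact: measurable_snd].
Qed.

Lemma cintegrable_fourier f q : test_fun f ->
  cintegrable (mu \x mu)%E (fun p => f p * expi (phase q p)).
Proof.
by move=> tf; apply: cintegrable_mul_expi; [exact: test_fun_integrable|exact: measurable_phase].
Qed.

Lemma cabs_imag (c : R) : cabs (0 +i* c) = `|c|.
Proof. by rewrite /cabs/cre/cim/= expr0n/= add0r sqrtr_sqr. Qed.

Lemma integral_slice_eq0 (c d : R) (F F' : R -> R[i]) (C C' : R) :
  0 <= C -> 0 <= C' ->
  (forall x, is_cderive F x (F' x)) -> ccontinuous F' ->
  (forall x, cabs (F x) <= C / (1 + x ^+ 2)) ->
  (forall x, cabs (F' x) <= C' / (1 + x ^+ 2)) ->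
  cintegral mu (fun x => F' x * expi (c * x + d) + (0 +i* c) * (F x * expi (c * x + d))) = 0.
Proof.
move=> C0 C'0 dF cF' hF hF'.
have cF : ccontinuous F by exact: is_cderive_continuous dF.
have ce : ccontinuous (fun x : R => expi (c * x + d)).
  apply: ccontinuous_expi => x; apply: cvgD; last exact: cvg_cst.
  by apply: cvgM; [exact: cvg_cst|exact: cvg_id].
apply: (@cintegral_cderive_eq0 _ (C + C' + `|c| * C) (fun x => F x * expi (c * x + d))).
- move=> x; apply: is_cderive_eq; first apply: is_cderiveM.
  + exact: dF.
  + have -> : (fun t : R => expi (c * t + d)) = (fun t => expi (c * t) * expi d).
      by apply/funext => t; rewrite expiD.
    by apply: is_cderiveM; [exact: is_cderive_expi|exact: is_cderive_cst].
  + by rewrite mulr0 addr0 -mulrA -expiD mulrCA.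
- apply: ccontinuousD; first exact: ccontinuousM.
  by apply: ccontinuousM; [exact: ccontinuous_cst|exact: ccontinuousM].
- move=> x; rewrite cabsM cabs_expi mulr1; apply: le_trans (hF x) _.
  rewrite ler_wpM2r ?invr_ge0 ?addr_ge0 ?sqr_ge0//.
  by rewrite -addrA lerDl addr_ge0// mulr_ge0.
- move=> x; apply: le_trans (cabsD _ _) _.
  rewrite (cabsM (F' x)) (cabsM (0 +i* c)) (cabsM (F x)) cabs_expi !mulr1 cabs_imag.
  rewrite [leRHS]mulrDl [X in _ <= X + _]mulrDl; have h1 := hF x; have h2 := hF' x.
  have h0 : 0 <= C / (1 + x ^+ 2) by rewrite divr_ge0// addr_ge0// sqr_ge0.
  have h3 : `|c| * cabs (F x) <= `|c| * C / (1 + x ^+ 2).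
    by rewrite -mulrA ler_wpM2l.
  lra.
Qed.

(** Integration by parts is done on each horizontal line, x being the inner variable in Fubini, and
    so amounts to the vanishing of the integral of a total derivative. *)
Lemma fourier2_pd1 f q : test_fun f ->
  fourier2 (pd1 f) q = (0 +i* (2 * pi * q.1)) * fourier2 f q.
Proof.
move=> tf; have tf' := test_fun_pd1 tf.
have i1 := cintegrable_fourier q tf; have i2 := cintegrable_fourier q tf'.
set c : R := - (2 * pi) * q.1.
have i3 : cintegrable (mu \x mu)%E (fun p => pd1 f p * expi (phase q p) +
    (0 +i* c) * (f p * expi (phase q p))).
  by apply: cintegrableD => //; exact: cintegrableM.
have H : cintegral (mu \x mu)%E (fun p => pd1 f p * expi (phase q p) +
    (0 +i* c) * (f p * expi (phase q p))) = 0.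
  rewrite -cintegral21_prod//; transitivity (cintegral mu (fun _ : R => 0 : R[i])); last exact: cintegral0.
  apply: eq_cintegral => y.
  have [C C0 hC] := test_fun_dominated tf; have [C' C'0 hC'] := test_fun_dominated tf'.
  (* On a fixed line the decay in y is dropped, leaving a majorant in x alone. *)
  have y1 : (1 + y ^+ 2)^-1 <= 1 :> R by rewrite invf_le1 ?lerDl ?sqr_ge0// ltr_pwDl// sqr_ge0.
  have sl (K : R) (x : R) : 0 <= K -> K * ((1 + x ^+ 2)^-1 * (1 + y ^+ 2)^-1) <= K / (1 + x ^+ 2).
    by move=> K0; apply: ler_wpM2l => //; apply: ler_piMr => //; rewrite invr_ge0 addr_ge0// sqr_ge0.
  have := @integral_slice_eq0 c (- (2 * pi) * (y * q.2)) (fun x => f (x, y)) (fun x => pd1 f (x, y))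
    C C' C0 C'0.
  move=> <-.
  - apply: eq_cintegral => x; rewrite /phase /c /=.
    by rewrite (_ : - (2 * pi) * (x * q.1 + y * q.2) = - (2 * pi) * q.1 * x + - (2 * pi) * (y * q.2))//; ring.
  - by move=> x; exact: is_cderive_pd1.
  - by apply: (@is_cderive_continuous _ _ (fun x => pd1 (pd1 f) (x, y))) => x; exact: is_cderive_pd1.
  - by move=> x; apply: le_trans (hC x y) _; exact: sl.
  - by move=> x; apply: le_trans (hC' x y) _; exact: sl.
rewrite cintegralD// in H; last exact: cintegrableM.
rewrite cintegralM// -!fourier2E in H.
have -> : 0 +i* (2 * pi * q.1) = - (0 +i* c) by rewrite /c; apply: cplx_eqP; rewrite ?creN ?cimN /cre/cim/= ?oppr0// mulNr opprK.
by rewrite mulNr; apply/eqP; rewrite -subr_eq0 opprK H.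
Qed.

Lemma fourier2_pd2 f q : test_fun f ->
  fourier2 (pd2 f) q = (0 +i* (2 * pi * q.2)) * fourier2 f q.
Proof.
move=> tf; have tf' := test_fun_pd2 tf.
have i1 := cintegrable_fourier q tf; have i2 := cintegrable_fourier q tf'.
set c : R := - (2 * pi) * q.2.
have i3 : cintegrable (mu \x mu)%E (fun p => pd2 f p * expi (phase q p) +
    (0 +i* c) * (f p * expi (phase q p))).
  by apply: cintegrableD => //; exact: cintegrableM.
have H : cintegral (mu \x mu)%E (fun p => pd2 f p * expi (phase q p) +
    (0 +i* c) * (f p * expi (phase q p))) = 0.
  rewrite -cintegral12_prod//; transitivity (cintegral mu (fun _ : R => 0 : R[i])); last exact: cintegral0.
  apply: eq_cintegral => x.
  have [C C0 hC] := test_fun_dominated tf; have [C' C'0 hC'] := test_fun_dominated tf'.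
  have x1 : (1 + x ^+ 2)^-1 <= 1 :> R by rewrite invf_le1 ?lerDl ?sqr_ge0// ltr_pwDl// sqr_ge0.
  have sl (K : R) (y : R) : 0 <= K -> K * ((1 + x ^+ 2)^-1 * (1 + y ^+ 2)^-1) <= K / (1 + y ^+ 2).
    by move=> K0; apply: ler_wpM2l => //; apply: ler_piMl => //; rewrite invr_ge0 addr_ge0// sqr_ge0.
  have := @integral_slice_eq0 c (- (2 * pi) * (x * q.1)) (fun y => f (x, y)) (fun y => pd2 f (x, y))
    C C' C0 C'0.
  move=> <-.
  - apply: eq_cintegral => y; rewrite /phase /c /=.
    by rewrite (_ : - (2 * pi) * (x * q.1 + y * q.2) = - (2 * pi) * q.2 * y + - (2 * pi) * (x * q.1))//; ring.
  - by move=> y; exact: is_cderive_pd2.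
  - by apply: (@is_cderive_continuous _ _ (fun y => pd2 (pd2 f) (x, y))) => y; exact: is_cderive_pd2.
  - by move=> y; apply: le_trans (hC x y) _; exact: sl.
  - by move=> y; apply: le_trans (hC' x y) _; exact: sl.
rewrite cintegralD// in H; last exact: cintegrableM.
rewrite cintegralM// -!fourier2E in H.
have -> : 0 +i* (2 * pi * q.2) = - (0 +i* c) by rewrite /c; apply: cplx_eqP; rewrite ?creN ?cimN /cre/cim/= ?oppr0// mulNr opprK.
by rewrite mulNr; apply/eqP; rewrite -subr_eq0 opprK H.
Qed.

Lemma fourier2_iter_pd1 n f q : test_fun f ->
  fourier2 (iter n (@pd1 R) f) q = (0 +i* (2 * pi * q.1)) ^+ n * fourier2 f q.
Proof.
move=> tf; elim: n => [|n ih]; first by rewrite expr0 mul1r.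
by rewrite /= fourier2_pd1 ?ih ?exprS ?mulrA//; exact: test_fun_iter_pd1.
Qed.

Lemma fourier2_iter_pd2 n f q : test_fun f ->
  fourier2 (iter n (@pd2 R) f) q = (0 +i* (2 * pi * q.2)) ^+ n * fourier2 f q.
Proof.
move=> tf; elim: n => [|n ih]; first by rewrite expr0 mul1r.
by rewrite /= fourier2_pd2 ?ih ?exprS ?mulrA//; exact: test_fun_iter_pd2.
Qed.

Lemma L1norm_ge0 f : 0 <= L1norm f.
Proof. by apply: Rintegral_ge0 => p _; exact: cabs_ge0. Qed.

Lemma cabs_fourier2 f q : test_fun f -> cabs (fourier2 f q) <= L1norm f.
Proof.
move=> tf; rewrite fourier2E; apply: le_trans (cabs_cintegral (cintegrable_fourier q tf)) _.
by under eq_Rintegral => p _ do rewrite cabsM cabs_expi mulr1.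
Qed.

(** The monomial is, up to powers of 2 pi >= 1, the symbol of a derivative of f, and the transform
    of that derivative is bounded by its L1 norm. *)
Lemma fourier2_decay f (a b : nat) : test_fun f -> exists2 C : R, 0 <= C &
  forall q, `|q.1| ^+ a * `|q.2| ^+ b * cabs (fourier2 f q) <= C.
Proof.
move=> tf; exists (L1norm (iter a (@pd1 R) (iter b (@pd2 R) f))); first exact: L1norm_ge0.
move=> q; have tb := test_fun_iter_pd2 b tf.
apply: le_trans (cabs_fourier2 q (test_fun_iter_pd1 a tb)).
rewrite fourier2_iter_pd1// fourier2_iter_pd2// !cabsM !cabsX !cabs_imag mulrA.
rewrite ler_wpM2r ?cabs_ge0//.
have pi1 : 1 <= 2 * pi :> R by have := pi_ge2 R; lra.
have h (x : R) n : `|x| ^+ n <= `|2 * pi * x| ^+ n.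
  rewrite lerXn2r ?nnegrE// normrM ler_peMl// ger0_norm//.
  by apply: le_trans pi1.
by rewrite ler_pM ?exprn_ge0.
Qed.

Lemma cmeasurable_fourier2 f : test_fun f -> cmeasurable (fourier2 f).
Proof.
move=> tf.
have mf : cmeasurable f by exact: cintegrable_measurable (test_fun_integrable tf).
have mF : cmeasurable (fun r : (R * R) * (R * R) => f r.2 * expi (phase r.1 r.2)).
  apply: cmeasurableM; first exact: (cmeasurable_comp measurable_snd mf).
  apply: cmeasurable_expi; apply: measurable_funM => //.
  have m1 : measurable_fun setT (fun r : (R * R) * (R * R) => r.1) by exact: measurable_fst.
  have m2 : measurable_fun setT (fun r : (R * R) * (R * R) => r.2) by exact: measurable_snd.
  apply: measurable_funD; apply: measurable_funM.
  - exact: (measurableT_comp measurable_fst m2).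
  - exact: (measurableT_comp measurable_fst m1).
  - exact: (measurableT_comp measurable_snd m2).
  - exact: (measurableT_comp measurable_snd m1).
exact: (@cmeasurable_cintegral_snd _ _ _ _ _ (@plane_measure R) _ mF).
Qed.

(** All the decay is taken from f, while the transform of g is just bounded. The four constants
    match the four monomials of (1 + x^2) (1 + y^2). *)
Lemma cintegrable_Wdot j i f g : test_fun f -> test_fun g ->
  cintegrable (mu \x mu)%E (fun q => fourier2 f q * conjc (fourier2 g q) *
    ((`|q.1| ^+ j * `|q.2| ^+ i)%:C)).
Proof.
move=> tf tg.
have [C1 C10 h1] := fourier2_decay j i tf.
have [C2 C20 h2] := fourier2_decay (j + 2) i tf.
have [C3 C30 h3] := fourier2_decay j (i + 2) tf.
have [C4 C40 h4] := fourier2_decay (j + 2) (i + 2) tf.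
pose C := (C1 + C2 + C3 + C4) * L1norm g.
apply: (@cintegrable_prod _ _ _ _ _ mu mu _ (fun x => C / (1 + x ^+ 2)) (fun y => (1 + y ^+ 2)^-1)).
- apply: cmeasurableM.
    apply: cmeasurableM; first exact: cmeasurable_fourier2.
    by apply: cmeasurable_conj; exact: cmeasurable_fourier2.
  apply: cmeasurable_real; apply: measurable_funM; apply: measurable_funX; apply: measurableT_comp => //;
    first [exact: measurable_fst|exact: measurable_snd].
- rewrite /comp; under eq_fun do rewrite EFinM.
  by apply: integrableZl => //; exact: integrable_oneDsqrV.
- exact: integrable_oneDsqrV.
move=> x y; rewrite !cabsM cabs_conj cabsR ger0_norm ?mulr_ge0 ?exprn_ge0//=.
have qx : 0 < 1 + x ^+ 2 by rewrite ltr_pwDl// sqr_ge0.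
have qy : 0 < 1 + y ^+ 2 by rewrite ltr_pwDl// sqr_ge0.
rewrite ler_pdivlMr// ler_pdivlMr//.
have := h1 (x, y); have := h2 (x, y); have := h3 (x, y); have := h4 (x, y).
rewrite /= !exprD !real_normK ?num_real//.
set F := cabs (fourier2 f (x, y)); set G := cabs (fourier2 g (x, y)).
move=> k4 k3 k2 k1.
have G1 : G <= L1norm g by exact: cabs_fourier2.
have F0 : 0 <= `|x| ^+ j * `|y| ^+ i * F * ((1 + x ^+ 2) * (1 + y ^+ 2)).
  by rewrite !mulr_ge0 ?exprn_ge0 ?cabs_ge0// ltW.
have k : `|x| ^+ j * `|y| ^+ i * F * ((1 + x ^+ 2) * (1 + y ^+ 2)) <= C1 + C2 + C3 + C4.
  rewrite (_ : _ * ((1 + _) * _) = `|x| ^+ j * `|y| ^+ i * F + `|x| ^+ j * x ^+ 2 * `|y| ^+ i * F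
    + `|x| ^+ j * (`|y| ^+ i * y ^+ 2) * F + `|x| ^+ j * x ^+ 2 * (`|y| ^+ i * y ^+ 2) * F); last by ring.
  lra.
rewrite (_ : _ * _ * _ = `|x| ^+ j * `|y| ^+ i * F * ((1 + x ^+ 2) * (1 + y ^+ 2)) * G); last by ring.
by rewrite /C ler_pM ?cabs_ge0.
Qed.

End FourierTransform.

(** * The bilinear estimate on a line of constant [eta] *)

Section Bilinear.
Context {R : realType}.
Implicit Types (f g h : R * R -> R[i]).
Notation mu := (@lebesgue_measure R).
Notation mu2 := (@plane_measure R).

(** Fubini moves the transform from h to the weight n. The phase in p.2 has modulus one and
    disappears, so the weight is transformed in one variable, at p.1. *)
Lemma cabs_cintegral_fourier2 h (n : R -> R[i]) (eta : R) : test_fun h -> cintegrable mu n ->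
  ((cabs (cintegral mu (fun xi => fourier2 h (xi, eta) * n xi)))%:E <=
   \int[mu2]_p ((cabs (h p))%:E *
     (cabs (cintegral mu (fun xi => n xi * expi (- (2 * pi) * p.1 * xi))))%:E))%E.
Proof.
move=> th iN; have ih := test_fun_integrable th.
have mN := cintegrable_measurable iN; have mh := cintegrable_measurable ih.
pose Phi (r : R * (R * R)) : R[i] := h r.2 * expi (phase (r.1, eta) r.2) * n r.1.
have m1 : measurable_fun setT (fun r : R * (R * R) => r.1) by exact: measurable_fst.
have m2 : measurable_fun setT (fun r : R * (R * R) => r.2) by exact: measurable_snd.
have mPhi : cmeasurable Phi.
  apply: cmeasurableM; last exact: (cmeasurable_comp m1 mN).
  apply: cmeasurableM; first exact: (cmeasurable_comp m2 mh).
  apply: cmeasurable_expi; apply: measurable_funM => //; apply: measurable_funD; apply: measurable_funM => //.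
  - exact: (measurableT_comp measurable_fst m2).
  - exact: (measurableT_comp measurable_snd m2).
have iPhi : cintegrable (mu \x mu2)%E Phi.
  apply: (@cintegrable_prod _ _ _ _ _ mu mu2 Phi (fun x => cabs (n x)) (fun p => cabs (h p))) => //.
  - exact: cintegrable_cabs.
  - exact: (cintegrable_cabs ih).
  - by move=> x p; rewrite /Phi !cabsM cabs_expi mulr1 mulrC.
have -> : cintegral mu (fun xi => fourier2 h (xi, eta) * n xi) =
    cintegral mu2 (fun p => cintegral mu (fun xi => Phi (xi, p))).
  rewrite (@cintegral21_prod _ _ _ _ _ mu mu2 Phi iPhi) -(@cintegral12_prod _ _ _ _ _ mu mu2 Phi iPhi).
  apply: eq_cintegral => xi; rewrite fourier2E -cintegralMr//.
  exact: cintegrable_fourier.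
have mS : cmeasurable (fun p => cintegral mu (fun xi => Phi (xi, p))).
  have mPhi' : cmeasurable (fun r : (R * R) * R => Phi (r.2, r.1)).
    have ms : measurable_fun setT (fun r : (R * R) * R => (r.2, r.1)).
      by apply: measurable_fun_pair; [exact: measurable_snd|exact: measurable_fst].
    exact: (cmeasurable_comp ms mPhi).
  exact: (@cmeasurable_cintegral_snd _ _ _ _ _ mu _ mPhi').
apply: le_trans (cabs_cintegral_le mu2 mS) _.
rewrite le_eqVlt; apply/orP; left; apply/eqP; apply: eq_integral => p _.
have -> : cintegral mu (fun xi => Phi (xi, p)) =
    h p * expi (- (2 * pi) * (p.2 * eta)) * cintegral mu (fun xi => n xi * expi (- (2 * pi) * p.1 * xi)).
  rewrite -cintegralM; last first.
    by apply: cintegrable_mul_expi => //; exact: measurable_funM.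
  apply: eq_cintegral => xi; rewrite /Phi /phase /=.
  have -> : - (2 * pi) * (p.1 * xi + p.2 * eta) = - (2 * pi) * (p.2 * eta) + - (2 * pi) * p.1 * xi :> R by ring.
  by rewrite expiD; ring.
by rewrite cabsM cabsM cabs_expi mulr1 EFinM.
Qed.

Definition wint (j i : nat) (c eta : R) : \bar R := (\int[mu]_xi (wker j i c eta xi)%:E)%E.

Lemma wint_ge0 j i c eta : (0 <= wint j i c eta)%E.
Proof. by apply: integral_ge0 => x _; rewrite lee_fin wker_ge0. Qed.

Lemma measurable_wint j i : measurable_fun setT (fun p : R * R => wint j i p.1 p.2).
Proof.
have mw : measurable_fun setT (fun r : (R * R) * R => (wker j i r.1.1 r.1.2 r.2)%:E).
  apply/measurable_EFinP; apply: measurable_wker; last exact: measurable_snd.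
  - exact: (measurableT_comp measurable_fst measurable_fst).
  - exact: (measurableT_comp measurable_snd measurable_fst).
have mF : measurable_fun setT (fubini_F mu (fun r : (R * R) * R => (wker j i r.1.1 r.1.2 r.2)%:E)).
  by apply: measurable_fun_fubini_tonelli_F => // r; rewrite lee_fin wker_ge0.
exact: mF.
Qed.

Definition slice_kernel (j i : nat) (a b : R[i]) (eta xi : R) : R[i] :=
  (`|eta| ^+ i)%:C * ker_fun j (a * (eta ^+ i.+1)%:C) (b * (eta ^+ i.+1)%:C) xi.

Definition slice_const (j : nat) (dl : R) : R := 2 * dl ^- 2 + 2 * j.+1%:R * dl ^- 3.

Lemma cintegrable_slice_ker_fun j i (a b : R[i]) (dl : R) : 0 < dl -> ~~ odd j ->
  0 < cim a * cim b -> a != b ->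
  (forall s v : R, dl * (`|s| + `|v|) <= cabs (s%:C - a * v%:C)) ->
  (forall s v : R, dl * (`|s| + `|v|) <= cabs (s%:C - b * v%:C)) ->
  forall eta : R, eta != 0 ->
    cintegrable mu (ker_fun j (a * (eta ^+ i.+1)%:C) (b * (eta ^+ i.+1)%:C)).
Proof.
move=> dl0 jeven ab0 ab Ha Hb eta eta0.
have v0 : eta ^+ i.+1 != 0 by rewrite expf_neq0.
have V0 : 0 < `|eta| ^+ i.+1 by rewrite exprn_gt0// normr_gt0.
set A := a * _; set B := b * _.
have AB0 : 0 < cim A * cim B.
  rewrite /A /B ![_ * (eta ^+ _)%:C]mulrC !cimCM mulrACA -expr2 mulr_gt0//.
  by rewrite lt_neqAle sqr_ge0 andbT eq_sym expf_neq0.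
have HA (x : R) : dl * (`|x| ^+ j.+1 + `|eta| ^+ i.+1) <= cabs ((x ^+ j.+1)%:C - A).
  by rewrite -!normrX; exact: Ha.
have HB (x : R) : dl * (`|x| ^+ j.+1 + `|eta| ^+ i.+1) <= cabs ((x ^+ j.+1)%:C - B).
  by rewrite -!normrX; exact: Hb.
have AB : A != B.
  rewrite /A /B -subr_eq0 -mulrBl mulf_neq0 ?subr_eq0//.
  by apply: contra_neq v0 => /(congr1 (@cre R)).
exact: (cintegrable_ker_fun V0 dl0 AB0 AB jeven HA HB).
Qed.

Lemma cintegrable_fourier2M h (n : R -> R[i]) (eta : R) : test_fun h -> cintegrable mu n ->
  cintegrable mu (fun xi => fourier2 h (xi, eta) * n xi) /\
  cintegrable mu (fun xi => conjc (fourier2 h (xi, eta)) * n xi).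
Proof.
move=> th iN; have mN := cintegrable_measurable iN.
have mh : cmeasurable (fun xi : R => fourier2 h (xi, eta)).
  apply: (cmeasurable_comp _ (cmeasurable_fourier2 th)).
  exact: measurable_fun_pair.
have iB : mu.-integrable setT (EFin \o (fun xi => L1norm h * cabs (n xi))).
  rewrite /comp; under eq_fun do rewrite EFinM.
  by apply: integrableZl => //; exact: cintegrable_cabs.
split; apply: (@le_cintegrable _ _ _ mu _ (fun xi => L1norm h * cabs (n xi))) => //.
- exact: cmeasurableM.
- by move=> xi; rewrite cabsM ler_wpM2r ?cabs_ge0//; exact: cabs_fourier2.
- by apply: cmeasurableM => //; exact: cmeasurable_conj.
- by move=> xi; rewrite cabsM cabs_conj ler_wpM2r ?cabs_ge0//; exact: cabs_fourier2.
Qed.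

(** [cabs_cintegral_fourier2] is used twice: for f with conj ghat times the kernel as weight, then
    for g inside the resulting integral. What is left is the transform of the kernel, bounded by
    [ker_hat_majorant]. *)
Lemma bilinear_kernel_bound j i (a b : R[i]) (dl : R) : 0 < dl -> ~~ odd j ->
  0 < cim a * cim b -> a != b ->
  (forall s v : R, dl * (`|s| + `|v|) <= cabs (s%:C - a * v%:C)) ->
  (forall s v : R, dl * (`|s| + `|v|) <= cabs (s%:C - b * v%:C)) ->
  forall f g (eta : R), test_fun f -> test_fun g -> eta != 0 ->
  ((cabs (cintegral mu (fun xi => fourier2 f (xi, eta) *
      (conjc (fourier2 g (xi, eta)) * slice_kernel j i a b eta xi))))%:E <=
   \int[mu2]_p ((cabs (f p))%:E * \int[mu2]_p' ((cabs (g p'))%:E *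
     ((slice_const j dl)%:E * wint j i (- (2 * pi) * (p.1 - p'.1)) eta))))%E.
Proof.
move=> dl0 jeven ab0 ab Ha Hb f g eta tf tg eta0.
have ik := cintegrable_slice_ker_fun i dl0 jeven ab0 ab Ha Hb eta0.
have iN := cintegrableM (`|eta| ^+ i)%:C ik.
pose A := a * (eta ^+ i.+1)%:C; pose B := b * (eta ^+ i.+1)%:C.
pose N := slice_kernel j i a b eta; rewrite -/A -/B in ik iN.
rewrite -[slice_kernel _ _ _ _ _]/N; rewrite -[fun x => _]/N in iN.
set C0 := slice_const j dl.
have mN := cintegrable_measurable iN.
have C00 : 0 <= C0.
  have dV n : 0 <= dl ^- n by rewrite invr_ge0 exprn_ge0// ltW.
  by apply: addr_ge0; apply: mulr_ge0 => //; apply: mulr_ge0.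
have [_ igN] := cintegrable_fourier2M eta tg iN.
have mlin (c : R) : measurable_fun setT (fun xi : R => c * xi) by exact: measurable_funM.
have KE (x : R) : cintegral mu (fun xi => N xi * expi (x * xi)) =
    (`|eta| ^+ i)%:C * ker_hat j A B x.
  rewrite /ker_hat -cintegralM.
    by apply: eq_cintegral => xi; rewrite mulrA.
  by apply: cintegrable_mul_expi.
have inner (x : R) : ((cabs (cintegral mu (fun xi =>
      conjc (fourier2 g (xi, eta)) * N xi * expi (- (2 * pi) * x * xi))))%:E <=
    \int[mu2]_p' ((cabs (g p'))%:E * (C0%:E * wint j i (- (2 * pi) * (x - p'.1)) eta)))%E.
  have iNe c : cintegrable mu (fun xi => N xi * expi (c * xi)) by exact: cintegrable_mul_expi.
  have iNc : cintegrable mu (fun xi => conjc (N xi * expi (- (2 * pi) * x * xi))).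
    apply: (@le_cintegrable _ _ _ mu _ (fun xi => cabs (N xi))).
    - by apply: cmeasurable_conj; exact: cintegrable_measurable.
    - by move=> xi; rewrite cabs_conj cabsM cabs_expi mulr1.
    - exact: cintegrable_cabs.
  (* Conjugating the whole integral preserves its modulus and turns conj ghat into ghat, to which
     [cabs_cintegral_fourier2] applies. *)
  have -> : cabs (cintegral mu (fun xi => conjc (fourier2 g (xi, eta)) * N xi * expi (- (2 * pi) * x * xi))) =
      cabs (cintegral mu (fun xi => fourier2 g (xi, eta) * conjc (N xi * expi (- (2 * pi) * x * xi)))).
    rewrite -[LHS]cabs_conj -cintegral_conj; last by apply: cintegrable_mul_expi.
    congr cabs; apply: eq_cintegral => xi.
    by rewrite (conjcM (_ * N xi)) (conjcM _ (N xi)) conjcK (conjcM (N xi)) mulrA.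
  apply: le_trans (cabs_cintegral_fourier2 eta tg iNc) _.
  have mZ1 : cmeasurable (fun p : R * R =>
      cintegral mu (fun xi => conjc (N xi * expi (- (2 * pi) * x * xi)) * expi (- (2 * pi) * p.1 * xi))).
    have mZ : cmeasurable (fun r : (R * R) * R =>
        conjc (N r.2 * expi (- (2 * pi) * x * r.2)) * expi (- (2 * pi) * r.1.1 * r.2)).
      apply: cmeasurableM.
        exact: (cmeasurable_comp measurable_snd (cintegrable_measurable iNc)).
      apply: cmeasurable_expi; apply: measurable_funM; last exact: measurable_snd.
      apply: measurable_funM => //.
      exact: (measurableT_comp measurable_fst measurable_fst).
    exact: (@cmeasurable_cintegral_snd _ _ _ _ _ mu _ mZ).
  have mg : measurable_fun setT (fun p : R * R => (cabs (g p))%:E).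
    apply/measurable_EFinP; apply: measurable_cabs.
    exact: (cintegrable_measurable (test_fun_integrable tg)).
  apply: ge0_le_integral => //.
  - by move=> p _; rewrite mule_ge0// lee_fin cabs_ge0.
  - by apply: emeasurable_funM => //; apply/measurable_EFinP; exact: measurable_cabs.
  - apply: emeasurable_funM => //; apply: measurable_funeM.
    have mc : measurable_fun setT (fun p : R * R => (- (2 * pi) * (x - p.1), eta)).
      apply: measurable_fun_pair => //; apply: measurable_funM => //; exact: measurable_funB.
    exact: (measurableT_comp (measurable_wint j i) mc).
  - move=> p _; apply: lee_wpmul2l; first by rewrite lee_fin cabs_ge0.
    (* Undoing the conjugation gives the two phases opposite signs, so the frequency depends on the
       difference x - p.1. *)
    have -> : cabs (cintegral mu (fun xi => conjc (N xi * expi (- (2 * pi) * x * xi)) * expi (- (2 * pi) * p.1 * xi))) =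
        cabs (cintegral mu (fun xi => N xi * expi (- (2 * pi) * (x - p.1) * xi))).
      rewrite -[RHS]cabs_conj -cintegral_conj//.
      congr cabs; apply: eq_cintegral => xi.
      rewrite !(conjcM (N xi)) !conj_expi -mulrA -expiD; congr (_ * expi _); ring.
    rewrite KE; apply: le_trans (ker_hat_majorant i dl0 jeven ab0 ab Ha Hb _ eta0) _.
    under eq_integral => xi _ do rewrite EFinM.
    rewrite ge0_integralZl_EFin//.
    + by move=> xi _; rewrite lee_fin wker_ge0.
    + apply/measurable_EFinP.
      exact: (@measurable_wker _ _ _ j i (fun _ : R => _) (fun _ : R => eta) (fun x : R => x)).
apply: le_trans (cabs_cintegral_fourier2 eta tf igN) _.
have mf : measurable_fun setT (fun p : R * R => (cabs (f p))%:E).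
  apply/measurable_EFinP; apply: measurable_cabs.
  exact: (cintegrable_measurable (test_fun_integrable tf)).
have mg : measurable_fun setT (fun p : R * R => (cabs (g p))%:E).
  apply/measurable_EFinP; apply: measurable_cabs.
  exact: (cintegrable_measurable (test_fun_integrable tg)).
apply: ge0_le_integral => //.
- by move=> p _; rewrite mule_ge0// lee_fin cabs_ge0.
- apply: emeasurable_funM => //; apply/measurable_EFinP; apply: measurable_cabs.
  have mZ : cmeasurable (fun r : (R * R) * R =>
      conjc (fourier2 g (r.2, eta)) * N r.2 * expi (- (2 * pi) * r.1.1 * r.2)).
    apply: cmeasurableM.
      exact: (cmeasurable_comp measurable_snd (cintegrable_measurable igN)).
    apply: cmeasurable_expi; apply: measurable_funM; last exact: measurable_snd.
    apply: measurable_funM => //.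
    exact: (measurableT_comp measurable_fst measurable_fst).
  exact: (@cmeasurable_cintegral_snd _ _ _ _ _ mu _ mZ).
- apply: emeasurable_funM => //.
  have mZ : measurable_fun setT (fun r : (R * R) * (R * R) => ((cabs (g r.2))%:E *
      (C0%:E * wint j i (- (2 * pi) * (r.1.1 - r.2.1)) eta))%E).
    apply: emeasurable_funM; first exact: (measurableT_comp mg measurable_snd).
    apply: measurable_funeM.
    have mc : measurable_fun setT (fun r : (R * R) * (R * R) => (- (2 * pi) * (r.1.1 - r.2.1), eta)).
      apply: measurable_fun_pair => //; apply: measurable_funM => //; apply: measurable_funB => //.
      - exact: (measurableT_comp measurable_fst measurable_fst).
      - exact: (measurableT_comp measurable_fst measurable_snd).
    exact: (measurableT_comp (measurable_wint j i) mc).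
  have mF : measurable_fun setT (fubini_F mu2 (fun r : (R * R) * (R * R) => ((cabs (g r.2))%:E *
      (C0%:E * wint j i (- (2 * pi) * (r.1.1 - r.2.1)) eta))%E)).
    apply: measurable_fun_fubini_tonelli_F => // r.
    by rewrite mule_ge0 ?lee_fin ?cabs_ge0// mule_ge0 ?lee_fin// wint_ge0.
  exact: mF.
- move=> p _; apply: lee_wpmul2l; first by rewrite lee_fin cabs_ge0.
  exact: inner.
Qed.

End Bilinear.

(** * Tonelli for a bilinear form depending on a parameter *)

Section Tonelli.
Context {R : realType} d d' (T : measurableType d) (U : measurableType d').
Variables (m : {sigma_finite_measure set T -> \bar R}) (nu : {sigma_finite_measure set U -> \bar R}).

Lemma measurable_bilinear (F G : T -> \bar R) (W : T -> T -> U -> \bar R) :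
  measurable_fun setT F -> measurable_fun setT G ->
  measurable_fun setT (fun r : (T * T) * U => W r.1.1 r.1.2 r.2) ->
  (forall p, 0 <= G p)%E -> (forall p q u, 0 <= W p q u)%E ->
  measurable_fun setT (fun r : U * T => (F r.2 * \int[m]_q (G q * W r.2 q r.1))%E).
Proof.
move=> mF mG mW G0 W0.
have GW0 p q u : (0 <= G q * W p q u)%E by exact: mule_ge0.
have mGW : measurable_fun setT (fun r : (U * T) * T => (G r.2 * W r.1.2 r.2 r.1.1)%E).
  apply: emeasurable_funM; first exact: (measurableT_comp mG measurable_snd).
  have mr : measurable_fun setT (fun r : (U * T) * T => ((r.1.2, r.2), r.1.1)).
    apply: measurable_fun_pair; last exact: (measurableT_comp measurable_fst measurable_fst).
    apply: measurable_fun_pair; last exact: measurable_snd.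
    exact: (measurableT_comp measurable_snd measurable_fst).
  exact: (measurableT_comp mW mr).
apply: emeasurable_funM; first exact: (measurableT_comp mF measurable_snd).
have mI := @measurable_fun_fubini_tonelli_F _ _ _ _ _ m _ mGW.
by apply: mI => r.
Qed.

(** Two exchanges bring the integral over u innermost, where W alone depends on u and is bounded
    uniformly in p and q. Here u is eta and C comes from [integral_wker]. *)
Lemma tonelli_bilinear_le (F G : T -> \bar R) (W : T -> T -> U -> \bar R) (C : R) :
  measurable_fun setT F -> measurable_fun setT G ->
  measurable_fun setT (fun r : (T * T) * U => W r.1.1 r.1.2 r.2) ->
  (forall p, 0 <= F p)%E -> (forall p, 0 <= G p)%E -> (forall p q u, 0 <= W p q u)%E ->
  0 <= C -> (forall p q, \int[nu]_u W p q u <= C%:E)%E ->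
  (\int[nu]_u \int[m]_p (F p * \int[m]_q (G q * W p q u)) <=
   C%:E * (\int[m]_p F p * \int[m]_q G q))%E.
Proof.
move=> mF mG mW F0 G0 W0 C0 WC.
have GW0 p q u : (0 <= G q * W p q u)%E by exact: mule_ge0.
have mH := measurable_bilinear mF mG mW G0 W0.
rewrite (@fubini_tonelli _ _ _ _ _ nu m _ mH) => [|r]; last by rewrite mule_ge0// integral_ge0.
have mGWp p : measurable_fun setT (fun r : U * T => (G r.2 * W p r.2 r.1)%E).
  apply: emeasurable_funM; first exact: (measurableT_comp mG measurable_snd).
  have mr : measurable_fun setT (fun r : U * T => ((p, r.2), r.1)).
    by apply: measurable_fun_pair => //; apply: measurable_fun_pair.
  exact: (measurableT_comp mW mr).
have mWp p q : measurable_fun setT (W p q).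
  have mr : measurable_fun setT (fun u : U => ((p, q), u)) by exact: measurable_fun_pair.
  exact: (measurableT_comp mW mr).
have bound p : (\int[nu]_u (F p * \int[m]_q (G q * W p q u)) <= F p * (C%:E * \int[m]_q G q))%E.
  have mI : measurable_fun setT (fun u => \int[m]_q (G q * W p q u))%E.
    have := @measurable_fun_fubini_tonelli_F _ _ _ _ _ m _ (mGWp p).
    by apply => r.
  rewrite ge0_integralZl//; last by move=> u _; exact: integral_ge0.
  apply: lee_wpmul2l => //.
  rewrite (@fubini_tonelli _ _ _ _ _ nu m _ (mGWp p)) => [|r //].
  rewrite -ge0_integralZl_EFin//.
  apply: ge0_le_integral => //.
  - by move=> q _; exact: integral_ge0.
  - have := @measurable_fun_fubini_tonelli_G _ _ _ _ _ nu _ (mGWp p).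
    by apply => r.
  - exact: measurable_funeM.
  move=> q _ /=; rewrite ge0_integralZl// muleC.
  exact: lee_wpmul2r.
apply: (@le_trans _ _ (\int[m]_p (F p * (C%:E * \int[m]_q G q)))%E).
  apply: ge0_le_integral => //.
  - by move=> p _; apply: integral_ge0 => u _; rewrite mule_ge0// integral_ge0.
  - have := @measurable_fun_fubini_tonelli_G _ _ _ _ _ nu _ mH.
    by apply => r; rewrite mule_ge0// integral_ge0.
  - exact: emeasurable_funM.
  - by move=> p _; exact: bound.
have IG0 : (0 <= \int[m]_q G q)%E by exact: integral_ge0.
rewrite ge0_integralZr// ?mule_ge0//.
by rewrite muleCA.
Qed.

End Tonelli.

(** * The differential equations on the Fourier side *)

Section Equation.
Context {R : realType}.
Implicit Types (f g h : R * R -> R[i]).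

Lemma fourier2_equation (k l : nat) (tau : R[i]) f f1 : test_fun f1 ->
  (forall p, iter k (@pd1 R) f1 p - tau * iter l (@pd2 R) f1 p = f p) ->
  forall q, fourier2 f q = ((0 +i* (2 * pi * q.1)) ^+ k - tau * (0 +i* (2 * pi * q.2)) ^+ l) * fourier2 f1 q.
Proof.
move=> tf1 /funext <- q.
have t1 := test_fun_iter_pd1 k tf1; have t2 := test_fun_iter_pd2 l tf1.
rewrite mulrBl -(mulrA tau) -fourier2_iter_pd1// -fourier2_iter_pd2// !fourier2E.
rewrite -mulNr -cintegralM; last exact: cintegrable_fourier.
rewrite -cintegralD; [|exact: cintegrable_fourier|by apply: cintegrableM; exact: cintegrable_fourier].
by apply: eq_cintegral => p; rewrite -mulNr mulrDl mulrA.
Qed.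

(** For z = 2 pi i this extracts z^k and leaves tau1 as coefficient. The exponent l - k may be
    negative, hence the integer power and z != 0. *)
Lemma symbol_eq (k l : nat) (z tau : R[i]) (x y : R) : z != 0 ->
  (z * x%:C) ^+ k - tau * (z * y%:C) ^+ l =
  z ^+ k * ((x ^+ k)%:C - z ^ (l%:Z - k%:Z) * tau * (y ^+ l)%:C).
Proof.
move=> z0; rewrite !exprMn mulrBr !rmorphXn; congr (_ - _).
have -> : z ^+ l = z ^+ k * z ^ (l%:Z - k%:Z).
  by rewrite !exprnP -expfzDr//; congr (z ^ _); lia.
by ring.
Qed.

End Equation.

(** * Assembling the estimate of the scalar product *)

Section Estimate.
Context {R : realType}.
Implicit Types (f g h : R * R -> R[i]).
Notation mu := (@lebesgue_measure R).
Notation mu2 := (@plane_measure R).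

Lemma integral_cabs_test_fun f : test_fun f ->
  (\int[mu2]_p (cabs (f p))%:E = (L1norm f)%:E)%E.
Proof.
move=> tf; rewrite /L1norm /Rintegral fineK//.
by apply: integrable_fin_num => //; exact: (cintegrable_cabs (test_fun_integrable tf)).
Qed.

Definition wconst (j i : nat) : R := 2 / i.+1%:R * (4 * j%:R + 6) * pi.

Lemma integral_slices_le j i (c : R) f g : test_fun f -> test_fun g -> 0 <= c ->
  let S eta := (\int[mu2]_p ((cabs (f p))%:E * \int[mu2]_p' ((cabs (g p'))%:E *
     (c%:E * wint j i (- (2 * pi) * (p.1 - p'.1)) eta))))%E in
  measurable_fun setT S /\
  (\int[mu]_eta S eta <= (c * wconst j i * L1norm f * L1norm g)%:E)%E.
Proof.
move=> tf tg c0 S.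
pose W (p p' : R * R) eta := (c%:E * wint j i (- (2 * pi) * (p.1 - p'.1)) eta)%E.
have mabs h : test_fun h -> measurable_fun setT (fun p => (cabs (h p))%:E).
  move=> th; apply/measurable_EFinP; apply: measurable_cabs.
  exact: (cintegrable_measurable (test_fun_integrable th)).
have mW : measurable_fun setT (fun r : ((R * R) * (R * R)) * R => W r.1.1 r.1.2 r.2).
  apply: measurable_funeM.
  have mc : measurable_fun setT (fun r : ((R * R) * (R * R)) * R =>
      (- (2 * pi) * (r.1.1.1 - r.1.2.1), r.2)).
    apply: measurable_fun_pair; last exact: measurable_snd.
    apply: measurable_funM => //; apply: measurable_funB.
    - apply: (measurableT_comp measurable_fst).
      exact: (measurableT_comp measurable_fst measurable_fst).
    - apply: (measurableT_comp measurable_fst).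
      exact: (measurableT_comp measurable_snd measurable_fst).
  exact: (measurableT_comp (measurable_wint j i) mc).
have W0 p q u : (0 <= W p q u)%E by rewrite mule_ge0 ?lee_fin// wint_ge0.
have abs0 h p : (0 <= (cabs (h p))%:E)%E by rewrite lee_fin cabs_ge0.
have mH := @measurable_bilinear R _ _ _ _ mu2 _ _ W (mabs _ tf) (mabs _ tg) mW (abs0 g) W0.
split.
  have := @measurable_fun_fubini_tonelli_F _ _ _ _ _ mu2 _ mH.
  by apply => r; rewrite mule_ge0// integral_ge0// => q _; rewrite mule_ge0.
have wc0 : 0 <= c * wconst j i.
  by rewrite /wconst; have := pi_ge0 R => ?; rewrite !mulr_ge0// addr_ge0// mulr_ge0.
apply: le_trans (@tonelli_bilinear_le R _ _ _ _ mu2 mu _ _ W (c * wconst j i)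
  (mabs _ tf) (mabs _ tg) mW (abs0 f) (abs0 g) W0 wc0 _) _.
  move=> p q; rewrite /W ge0_integralZl_EFin//.
  - by rewrite EFinM lee_wpmul2l ?lee_fin//; exact: integral_wker.
  - by move=> eta _; exact: wint_ge0.
  - have mc : measurable_fun setT (fun eta : R => (- (2 * pi) * (p.1 - q.1), eta)).
      exact: measurable_fun_pair.
    exact: (measurableT_comp (measurable_wint j i) mc).
by rewrite !integral_cabs_test_fun// -!EFinM lee_fin !mulrA.
Qed.

Lemma symbol_neq0 (a : R[i]) (dl : R) (s v : R) : 0 < dl -> v != 0 ->
  (forall s v : R, dl * (`|s| + `|v|) <= cabs (s%:C - a * v%:C)) -> s%:C - a * v%:C != 0.
Proof.
move=> dl0 v0 Ha; rewrite -cabs_gt0; apply: lt_le_trans (Ha s v).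
by rewrite mulr_gt0// ltr_wpDl// normr_gt0.
Qed.

Lemma cabs_Wdot_le j i (a b z w : R[i]) (dl : R) : 0 < dl -> ~~ odd j ->
  0 < cim a * cim b -> a != b -> 1 <= cabs z -> 1 <= cabs w ->
  (forall s v : R, dl * (`|s| + `|v|) <= cabs (s%:C - a * v%:C)) ->
  (forall s v : R, dl * (`|s| + `|v|) <= cabs (s%:C - b * v%:C)) ->
  forall f g f1 g1, test_fun f -> test_fun g -> test_fun f1 -> test_fun g1 ->
  (forall q, fourier2 f q = z * ((q.1 ^+ j.+1)%:C - a * (q.2 ^+ i.+1)%:C) * fourier2 f1 q) ->
  (forall q, conjc (fourier2 g q) =
     w * ((q.1 ^+ j.+1)%:C - b * (q.2 ^+ i.+1)%:C) * conjc (fourier2 g1 q)) ->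
  cabs (Wdot j.+1 i.+1 f1 g1) <= slice_const j dl * wconst j i * L1norm f * L1norm g.
Proof.
move=> dl0 jeven ab0 ab z1 w1 Ha Hb f g f1 g1 tf tg tf1 tg1 Ef Eg.
have z0 : z != 0 by rewrite -cabs_gt0 (lt_le_trans _ z1).
have w0 : w != 0 by rewrite -cabs_gt0 (lt_le_trans _ w1).
have iF := cintegrable_Wdot j i tf1 tg1.
set F := (fun q : R * R => _) in iF.
have -> : Wdot j.+1 i.+1 f1 g1 = cintegral (mu \x mu)%E F by rewrite /Wdot !subn1.
have C00 : 0 <= slice_const j dl.
  have dV n : 0 <= dl ^- n by rewrite invr_ge0 exprn_ge0// ltW.
  by apply: addr_ge0; apply: mulr_ge0 => //; apply: mulr_ge0.
have [mS IS] := integral_slices_le j i tf tg C00.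
rewrite -lee_fin; apply: le_trans IS.
rewrite -(@cintegral21_prod _ _ _ _ _ mu mu F iF).
have mI : cmeasurable (fun eta => cintegral mu (fun xi => F (xi, eta))).
  have mF : cmeasurable (fun r : R * R => F (r.2, r.1)).
    apply: (cmeasurable_comp _ (cintegrable_measurable iF)).
    exact: measurable_fun_pair.
  exact: (@cmeasurable_cintegral_snd _ _ _ _ _ mu _ mF).
apply: le_trans (cabs_cintegral_le mu mI) _.
apply: ae_ge0_le_integral => //.
- by move=> eta _; rewrite lee_fin cabs_ge0.
- by apply/measurable_EFinP; exact: measurable_cabs.
- move=> eta _; apply: integral_ge0 => p _; rewrite mule_ge0 ?lee_fin ?cabs_ge0//.
  apply: integral_ge0 => q _; rewrite mule_ge0 ?lee_fin ?cabs_ge0//.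
  by rewrite mule_ge0 ?lee_fin// wint_ge0.
exists [set 0]; split => //; first exact: lebesgue_measure_set1.
move=> eta /= H; apply: contra_notP H => /eqP eta0 _.
apply: le_trans (bilinear_kernel_bound i dl0 jeven ab0 ab Ha Hb tf tg eta0).
have ik := cintegrable_slice_ker_fun i dl0 jeven ab0 ab Ha Hb eta0.
have iK := cintegrableM (`|eta| ^+ i)%:C ik.
have [_ igK] := cintegrable_fourier2M eta tg iK.
have [ifgK _] := cintegrable_fourier2M eta tf igK.
have v0 : eta ^+ i.+1 != 0 by rewrite expf_neq0.
have -> : cintegral mu (fun xi => F (xi, eta)) = (z * w)^-1 * cintegral mu (fun xi =>
    fourier2 f (xi, eta) * (conjc (fourier2 g (xi, eta)) * slice_kernel j i a b eta xi)).
  rewrite -cintegralM//; apply: eq_cintegral => xi.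
  have nA := @symbol_neq0 a dl (xi ^+ j.+1) _ dl0 v0 Ha.
  have nB := @symbol_neq0 b dl (xi ^+ j.+1) _ dl0 v0 Hb.
  (* Evenness of j turns |xi|^j into xi^j, the numerator of [ker_fun]. *)
  rewrite Eg Ef /F /slice_kernel /ker_fun /= -normrX ger0_norm ?exprn_even_ge0//.
  rewrite rmorphM.
  move: nA nB; set P := _ - a * _; set Q := _ - b * _ => nA nB.
  by field; rewrite nA nB z0 w0.
rewrite lee_fin cabsM cabsV cabsM ler_piMl ?cabs_ge0// invf_le1 ?mulr_gt0 ?cabs_gt0//.
by rewrite -[1]mulr1 ler_pM.
Qed.

End Estimate.

Theorem theorem6 (R : realType) (k l : nat) (sigma tau : R[i]) :
  (0 < k)%N -> (0 < l)%N -> odd k ->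
  sigma != 0 -> tau != 0 ->
  let tau1 := (0 +i* (2 * pi)) ^ (l%:Z - k%:Z) * tau in
  let sigma1 := (-1) ^ (l%:Z - k%:Z) * (0 +i* (2 * pi)) ^ (l%:Z - k%:Z) * conjc sigma in
  tau1 != sigma1 ->
  cim tau1 != 0 -> cim sigma1 != 0 -> 0 < cim tau1 * cim sigma1 ->
  exists C : R, forall f g f1 g1 : R * R -> R[i],
    test_fun f -> test_fun g -> test_fun f1 -> test_fun g1 ->
    (forall p, iter k (@pd1 R) f1 p - tau * iter l (@pd2 R) f1 p = f p) ->
    (forall p, iter k (@pd1 R) g1 p - sigma * iter l (@pd2 R) g1 p = g p) ->
    cabs (Wdot k l f1 g1) <= C * L1norm f * L1norm g.
Proof.
case: k => // j; case: l => // i _ _ jeven _ _ tau1 sigma1 ts t0 s0 ts0.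
pose I : R[i] := 0 +i* (2 * pi).
have IE (x : R) : 0 +i* (2 * pi * x) = I * x%:C.
  by apply: cplx_eqP; rewrite ?creM ?cimM /I /cre /cim /=; ring.
have cabsI : 1 <= cabs I.
  by rewrite cabs_imag ger0_norm ?mulr_ge0 ?pi_ge0//; have := pi_ge2 R; lra.
have I0 : I != 0 by rewrite -cabs_gt0 (lt_le_trans _ cabsI).
have cI : conjc I = (-1) * I by apply: cplx_eqP; rewrite ?creM ?cimM /I /cre /cim /=; ring.
have cI0 : conjc I != 0 by rewrite -cabs_gt0 cabs_conj cabs_gt0.
(* The sign (-1)^(l-k) in sigma1 is the effect of conjugating 2 pi i, so the conjugated equation for
   g1 also fits [symbol_eq], with z = conj (2 pi i). *)
have sE : sigma1 = conjc I ^ (i.+1%:Z - j.+1%:Z) * conjc sigma by rewrite cI expfzMl.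
have [d1 d10 H1] := cabs_sub_ge t0; have [d2 d20 H2] := cabs_sub_ge s0.
pose dl := Num.min d1 d2.
have dl0 : 0 < dl by rewrite lt_min d10 d20.
have Ht (s v : R) : dl * (`|s| + `|v|) <= cabs (s%:C - tau1 * v%:C).
  by apply: le_trans (H1 s v); rewrite ler_wpM2r ?addr_ge0// ge_min lexx.
have Hs (s v : R) : dl * (`|s| + `|v|) <= cabs (s%:C - sigma1 * v%:C).
  by apply: le_trans (H2 s v); rewrite ler_wpM2r ?addr_ge0// ge_min lexx orbT.
exists (slice_const j dl * wconst j i) => f g f1 g1 tf tg tf1 tg1 Ef Eg.
apply: (@cabs_Wdot_le _ j i tau1 sigma1 (I ^+ j.+1) (conjc I ^+ j.+1) dl) => //.
- by rewrite cabsX exprn_ege1.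
- by rewrite cabsX cabs_conj exprn_ege1.
- by move=> q; rewrite (fourier2_equation tf1 Ef) !IE symbol_eq.
- move=> q; rewrite (fourier2_equation tg1 Eg) !IE conjcM; congr (_ * _).
  rewrite sE -symbol_eq// rmorphB rmorphM !rmorphXn !rmorphM /=.
  by rewrite oppr0.
Qed.
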